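(* For all $\alpha\in[0,1/2)$, there exists a random velocity field $u:[0,1]\times\mathbb{R}^2\to\mathbb{R}^2$ such that, surely, $\|u(t,\cdot)\|_{C^\alpha(\mathbb{R}^2)}\le 2$ for all $t\in[0,1]$. The velocity field $u$ has the property that for any deterministic $W\in C^\beta([0,1],\mathbb{R}^2)$ with $\beta>\frac{1}{2(1-\alpha)}$ and any $y\in\mathbb{R}^2$, the ODE $$dX_t=u(t,X_t)\,dt+dW_t,\qquad X_0=y,$$ almost surely in $u$, has nonunique Carathéodory solutions on $[0,\varepsilon]$ for every $\varepsilon>0$.
   Context: $\|\cdot\|_{C^\alpha}$ for $\alpha\in[0,1)$ is the usual Hölder norm ($C^0$ has the sup norm). For $u\in L^1([0,T],C^0(\mathbb{R}^d))$ and deterministic $W\in C^0([0,T],\mathbb{R}^d)$, $X\in C^0([0,T],\mathbb{R}^d)$ is a Carathéodory solution if $X_t=y+\int_0^t u(s,X_s)\,ds+W_t-W_0$ for all $t\in[0,T]$. Standing assumption: drifts belong to $L^1([0,T],C^0(\mathbb{R}^d))$. *)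

(* Defs.v *)
From HB Require Import structures.
From mathcomp Require Import all_boot all_order all_algebra.
From mathcomp Require Import all_classical all_reals all_analysis.
Set Implicit Arguments.
Unset Strict Implicit.
Unset Printing Implicit Defensive.
Import Order.TTheory GRing.Theory Num.Theory.
Import numFieldNormedType.Exports.
Local Open Scope classical_set_scope.
Local Open Scope ring_scope.

(* Vectors of R^d are row vectors.  The library norm on 'rV[R]_d is the max
   norm, hence the explicit Euclidean norm; both give the same topology. *)
Definition eucl_norm (R : realType) (d : nat) (x : 'rV[R]_d) : R :=
  Num.sqrt (\sum_(i < d) x 0 i ^+ 2).

Definition eucl_dist (R : realType) (d : nat) (x y : 'rV[R]_d) : R := eucl_norm (x - y).

Definition abs_dist (R : realType) (s t : R) : R := `|s - t|.

Definition sup_norm (R : realType) (T : Type) (d : nat) (D : set T)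
    (f : T -> 'rV[R]_d) : \bar R :=
  ereal_sup [set (eucl_norm (f x))%:E | x in D].

Definition holder_seminorm (R : realType) (T : Type) (d : nat)
    (dist : T -> T -> R) (D : set T) (a : R) (f : T -> 'rV[R]_d) : \bar R :=
  ereal_sup [set (eucl_norm (f p.1 - f p.2) / (dist p.1 p.2 `^ a))%:E
            | p in [set p : T * T | [/\ D p.1, D p.2 & p.1 <> p.2]]].

(* C^0 carries the sup norm alone. *)
Definition holder_norm (R : realType) (T : Type) (d : nat)
    (dist : T -> T -> R) (D : set T) (a : R) (f : T -> 'rV[R]_d) : \bar R :=
  if a == 0 then sup_norm D f
  else (sup_norm D f + holder_seminorm dist D a f)%E.

(* Continuity is only a constraint when a = 0: C^0 is the space of bounded
   continuous functions. *)
Definition in_holder (R : realType) (T : topologicalType) (d : nat)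
    (dist : T -> T -> R) (D : set T) (a : R) (f : T -> 'rV[R]_d) : Prop :=
  {within D, continuous f} /\ (holder_norm dist D a f < +oo)%E.

Definition in_C0 (R : realType) (d : nat) (f : 'rV[R]_d -> 'rV[R]_d) : Prop :=
  in_holder (@eucl_dist R d) setT 0 f.

Definition C0_simple (R : realType) (d : nat) (D : set R)
    (s : R -> 'rV[R]_d -> 'rV[R]_d) : Prop :=
  [/\ finite_set (s @` D),
      forall f, measurable [set t | D t /\ s t = f]
    & forall t, D t -> in_C0 (s t)].

(* The Bochner space L^1([0, tmax], C^0(R^d)): since C^0(R^d) is not separable,
   measurability in time is strong measurability, i.e. almost everywhere
   approximation by simple functions in the sup norm. *)
Definition in_L1C0 (R : realType) (d : nat) (tmax : R)
    (u : R -> 'rV[R]_d -> 'rV[R]_d) : Prop :=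
  [/\ {ae lebesgue_measure, forall t : R, t \in `[0, tmax] -> in_C0 (u t)},
      exists s : nat -> R -> 'rV[R]_d -> 'rV[R]_d,
        (forall n, C0_simple `[0, tmax] (s n)) /\
        {ae lebesgue_measure, forall t : R, t \in `[0, tmax] ->
          (fun n => sup_norm setT (fun x => s n t x - u t x)) @ \oo --> 0%E}
    & (\int[lebesgue_measure]_(t in `[0%R, tmax]) sup_norm setT (u t) < +oo)%E].

Definition is_caratheodory (R : realType) (d : nat) (tmax : R)
    (u : R -> 'rV[R]_d -> 'rV[R]_d) (W : R -> 'rV[R]_d) (y : 'rV[R]_d)
    (X : R -> 'rV[R]_d) : Prop :=
  {within `[0, tmax], continuous X} /\
  forall t : R, t \in `[0, tmax] ->
    X t = y + \row_(i < d) Rintegral lebesgue_measure `[0, t]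
                             (fun s => u s (X s) 0 i)
          + W t - W 0.

Definition nonunique_caratheodory (R : realType) (d : nat) (tmax : R)
    (u : R -> 'rV[R]_d -> 'rV[R]_d) (W : R -> 'rV[R]_d) (y : 'rV[R]_d) : Prop :=
  exists X1 X2 : R -> 'rV[R]_d,
    [/\ is_caratheodory tmax u W y X1, is_caratheodory tmax u W y X2
      & exists2 t : R, t \in `[0, tmax] & X1 t <> X2 t].

(* R^d with its Borel sigma-algebra. *)
Definition borel_rV (R : realType) (d : nat) :=
  g_sigma_algebraType (@open 'rV[R]_d).

(* A random drift on [0, tmax]: jointly measurable in (omega, t, x), and every
   realization lies in L^1([0, tmax], C^0(R^d)). *)
Definition random_field (R : realType) (dsp : measure_display)
    (Omega : measurableType dsp) (d : nat) (tmax : R)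
    (u : Omega -> R -> 'rV[R]_d -> 'rV[R]_d) : Prop :=
  (forall i : 'I_d,
     measurable_fun [set p : Omega * R * borel_rV R d | p.1.2 \in `[0, tmax]]
       (fun p : Omega * R * borel_rV R d => u p.1.1 p.1.2 p.2 0 i)) /\
  (forall omega : Omega, in_L1C0 tmax (u omega)).

(* Main.v *)
Require Import Defs.
From HB Require Import structures.
From mathcomp Require Import all_boot all_order all_algebra.
From mathcomp Require Import all_classical all_reals all_analysis.
From mathcomp Require Import measurable_realfun ring lra.
Import Order.TTheory GRing.Theory Num.Theory.
Import numFieldNormedType.Exports.
Local Open Scope classical_set_scope.
Local Open Scope ring_scope.

Set Implicit Arguments.
Unset Strict Implicit.

(** Time runs through infinitely many steps that accumulate at time 0.  During
    step [j] the drift is a shear flow of wave length about [scl j] and amplitude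
    about [scl j ^ alpha], which bounds its Hoelder norm; its direction (one of
    four) and its phase (one of four) are chosen by the [j]-th digit in base 16
    of a uniform random number, so the steps are independent.

    Fix the perturbation [W] and subtract it.  A shear only moves points
    orthogonally to its wave vector, hence its effect during a step is an explicit
    homeomorphism of the plane, in which [W] enters through the integrals over
    the step of the cosine and the sine of the angle [k.W / scl j].  A [beta]-Hoelder path
    with [beta] above the critical exponent moves much less than [scl j] in one
    step, so the sum of the squares of these two integrals is nearly the square of
    the duration ([trig_int_sqr_ge]).  Since the phase is random, the displacement
    between two trajectories has, whatever [W] is, nearly the same second moments
    as without [W].

    In the plane such an isotropic and incompressible random displacement makes
    two close points separate: the mean of the inverse of their distance contracts
    by a factor [1 - c * rate j ^ 2] in each step, as a second-order expansion shows
    ([inv_dist_shift_avg]).  The parameters are chosen so that this contraction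
    is stronger than the change of scale ([near_sclS_ge]).  Consequently two
    trajectories started from points at distance [scl N] at [time N] have, at a fixed later
    [time m], an inverse distance whose mean is bounded independently of [N]
    ([avg_inv_dist_le]).  Therefore almost surely, for some [rho > 0] and
    infinitely many [N], they are at distance at least [rho] at [time m]
    ([ae_frequently_ge]).

    Let [N] grow.  By compactness there are two distinct points at [time m] whose
    backward orbits both converge to the initial point ([separated_limits]), and
    each such orbit is a Caratheodory solution ([orbit_sol_caratheodory]).  The step
    maps are injective, so the two solutions differ at [time j] for every [j >= m],
    that is, at arbitrarily small times.

    The condition on [beta] comes from the balance between two requirements.
    Contraction over a time of order one, up to logarithms, needs a duration of
    order [scl j ^ (2 * (1 - alpha))], because the gain is quadratic in the
    displacement; and [W] may not move by more than [scl j] during this time. *)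

(** * Times, length scales and amplitudes of the steps *)

Lemma one_powR (R : realType) (x : R) : 1 `^ x = 1.
Proof. by rewrite powR1. Qed.

Section parameters.
Context (R : realType).
Implicit Types (j : nat).

(** Step [j] occupies the interval from [time j.+1] to [time j].  The times tend
    to [0], but more slowly than any power of [j]: the durations are then of
    order [j^-1] up to logarithms, and no power of the scales is lost in the
    total time available at each scale. *)
Definition logstep j : R := 1 + ln j.+1%:R.

Definition time j : R := (logstep j)^-1.

Definition dur j : R := time j - time j.+1.

Lemma logstep_ge1 j : 1 <= logstep j.
Proof. by rewrite lerDl ln_ge0// ler1n. Qed.

Lemma logstep_gt0 j : 0 < logstep j.
Proof. exact: lt_le_trans (logstep_ge1 j). Qed.

Lemma time0 : time 0 = 1.
Proof. by rewrite /time /logstep ln1 addr0 invr1. Qed.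

Lemma time_gt0 j : 0 < time j.
Proof. by rewrite invr_gt0 logstep_gt0. Qed.

Lemma time_le1 j : time j <= 1.
Proof. by rewrite invf_le1 ?logstep_gt0// logstep_ge1. Qed.

Lemma logstepS_bounds j :
  j.+2%:R^-1 <= logstep j.+1 - logstep j <= j.+1%:R^-1.
Proof.
have p1 : (0 : R) < j.+1%:R by [].
have p2 : (0 : R) < j.+2%:R by [].
have -> : logstep j.+1 - logstep j = ln (j.+2%:R / j.+1%:R).
  by rewrite ln_div ?posrE// /logstep; ring.
have e1 : (j.+2%:R / j.+1%:R : R) = 1 + j.+1%:R^-1.
  by rewrite -[in LHS]nat1r mulrDl mul1r mulfV ?gt_eqF// addrC.
have e2 : (j.+1%:R / j.+2%:R : R) = 1 - j.+2%:R^-1.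
  by rewrite -[X in _ = X - _](mulfV (lt0r_neq0 p2)) -[in RHS]nat1r; field; rewrite nat1r gt_eqF.
have i0 : 0 < j.+1%:R^-1 :> R by rewrite invr_gt0.
have i1 : j.+2%:R^-1 < 1 :> R by rewrite invf_lt1// ltr1n.
apply/andP; split; last first.
  by rewrite e1; apply: le_ln1Dx; rewrite (lt_trans _ i0)// ltrN10.
rewrite -[X in ln X]invrK invf_div lnV ?posrE ?divr_gt0// e2.
by rewrite lerNr; apply: le_ln1Dx; rewrite ltrN2.
Qed.

Lemma logstepS_gt j : logstep j < logstep j.+1.
Proof.
have /andP[+ _] := logstepS_bounds j; rewrite -subr_gt0; apply: lt_le_trans.
by rewrite invr_gt0.
Qed.

Lemma dur_gt0 j : 0 < dur j.
Proof. by rewrite subr_gt0 ltf_pV2 ?posrE ?logstep_gt0// logstepS_gt. Qed.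

Lemma timeS_lt j : time j.+1 < time j.
Proof. by rewrite -subr_gt0 dur_gt0. Qed.

Lemma time_nincr : {homo time : i j / (i <= j)%N >-> j <= i}.
Proof.
by apply: homo_leq => [//|x y z ? h|j]; [exact: le_trans h _|exact/ltW/timeS_lt].
Qed.

Lemma durE j : dur j = (logstep j.+1 - logstep j) * (time j * time j.+1).
Proof.
rewrite /dur /time; have := logstep_gt0 j; have := logstep_gt0 j.+1 => *.
by field; rewrite !gt_eqF.
Qed.

Lemma dur_le j : dur j <= time j ^+ 2 / j.+1%:R.
Proof.
have := time_gt0 j; have := time_gt0 j.+1 => /ltW h1 /ltW h0.
rewrite durE mulrC expr2 ler_pM//.
- by rewrite mulr_ge0.
- by rewrite subr_ge0 ltW// logstepS_gt.
- by rewrite ler_wpM2l// time_nincr.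
- by have /andP[] := logstepS_bounds j.
Qed.

Lemma dur_le_inv j : dur j <= j.+1%:R^-1.
Proof.
apply: (le_trans (dur_le j)); rewrite ler_piMl ?invr_ge0//.
by rewrite exprn_ile1 ?time_le1// ltW// time_gt0.
Qed.

Lemma timeS_ge j : (1 - j.+1%:R^-1) * time j <= time j.+1.
Proof.
have : dur j <= time j / j.+1%:R.
  apply: (le_trans (dur_le j)); rewrite ler_pM2r ?invr_gt0// expr2.
  by apply: ler_piMr; rewrite ?time_le1// ltW// time_gt0.
by rewrite /dur mulrBl mul1r [_^-1 * _]mulrC; set x := _ / _; lra.
Qed.

Lemma dur_ge j : (0 < j)%N -> time j ^+ 2 / (4 * j.+1%:R) <= dur j.
Proof.
move=> j0; rewrite durE.
have /andP[+ _] := logstepS_bounds j.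
have t0 := time_gt0 j.
have ts : time j / 2 <= time j.+1.
  apply: (le_trans _ (timeS_ge j)); rewrite mulrC ler_pM2r//.
  have : j.+1%:R^-1 <= 2^-1 :> R.
    by rewrite lef_pV2 ?posrE// ler_nat.
  by set x := j.+1%:R^-1; lra.
have h2 : (2 * j.+1%:R)^-1 <= j.+2%:R^-1 :> R.
  by rewrite lef_pV2 ?posrE ?mulr_gt0// -natrM ler_nat mul2n -addnn addSn addnS !ltnS leq_addr.
move=> h; have {}h := le_trans h2 h.
rewrite (_ : _ / _ = (2 * j.+1%:R)^-1 * (time j * (time j / 2))); last first.
  by field; rewrite nat1r pnatr_eq0.
apply: ler_pM => //; first by rewrite !mulr_ge0 ?(ltW t0).
by rewrite ler_pM2l.
Qed.

(** Used to absorb the powers of [logstep] contained in the scales. *)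
Lemma logstep_le_powR (d : R) j : 0 < d -> logstep j <= (1 + d^-1) * j.+1%:R `^ d.
Proof.
move=> d0; have n1 : 1 <= j.+1%:R :> R by rewrite ler1n.
have p1 : 1 <= j.+1%:R `^ d :> R by rewrite -[leLHS](powRr0 j.+1%:R) ler_powR// ltW.
rewrite mulrDl mul1r lerD// ler_pdivlMl// -ln_powR.
by apply/ltW/ln_sublinear/powR_gt0.
Qed.

Lemma near_natS_ge (a : R) : \forall j \near \oo, a <= j.+1%:R.
Proof.
near=> j; apply: (@le_trans _ _ j%:R); last by rewrite ler_nat.
by near: j; exact: nbhs_infty_ger.
Unshelve. all: by end_near. Qed.

Lemma near_logstep_ge (a : R) : \forall j \near \oo, a <= logstep j.
Proof.
near=> j; apply: (@le_trans _ _ (ln j.+1%:R)); last by rewrite lerDr.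
rewrite -[leLHS]expRK ler_ln ?posrE ?expR_gt0//.
by near: j; exact: near_natS_ge.
Unshelve. all: by end_near. Qed.

Lemma near_time_le (a : R) : 0 < a -> \forall j \near \oo, time j <= a.
Proof.
move=> a0; near=> j; rewrite -[leRHS]invrK lef_pV2 ?posrE ?invr_gt0 ?logstep_gt0//.
by near: j; exact: near_logstep_ge.
Unshelve. all: by end_near. Qed.

Context (alpha : R).

(** The critical Hoelder exponent of the perturbation. *)
Definition hexp : R := 1 / (2 * (1 - alpha)).

(** The length scale of step [j].  Write [g = scl j `^ (2 * (1 - alpha))]: a
    random walk with steps of relative size [rate j] separates points by a
    factor of order [1 + rate j ^+ 2 = 1 + dur j ^+ 2 / (4 * g)] per step, while
    the scales change by the factor [1 + O(j^-1)].  Hence [g] has to be a little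
    smaller than [j^-1], which the power of [time j] provides. *)
Definition scl j : R := (time j ^+ 5 / j.+1%:R) `^ hexp.

Definition amp j : R := scl j `^ alpha / 2.

(** The displacement gradient of one step, the small parameter of the
    expansion. *)
Definition rate j : R := amp j * dur j / scl j.

Let base_gt0 j : 0 < time j ^+ 5 / j.+1%:R.
Proof. by rewrite divr_gt0// exprn_gt0// time_gt0. Qed.

Lemma scl_gt0 j : 0 < scl j.
Proof. by rewrite powR_gt0. Qed.

Lemma amp_gt0 j : 0 < amp j.
Proof. by rewrite divr_gt0// powR_gt0 ?scl_gt0. Qed.

Lemma rate_gt0 j : 0 < rate j.
Proof. by rewrite divr_gt0 ?scl_gt0// mulr_gt0 ?amp_gt0 ?dur_gt0. Qed.

Hypotheses (alpha_ge0 : 0 <= alpha) (alpha_lt : alpha < 1 / 2).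

Lemma hexp_gt0 : 0 < hexp.
Proof.
have h : 0 < 2 * (1 - alpha) by have := alpha_lt; lra.
by rewrite /hexp divr_gt0.
Qed.

Lemma hexp_le1 : hexp <= 1.
Proof.
have h : 0 < 2 * (1 - alpha) by have := alpha_lt; lra.
by rewrite /hexp ler_pdivrMr// mul1r; have := alpha_lt; lra.
Qed.

Lemma scl_le1 j : scl j <= 1.
Proof.
rewrite -(one_powR hexp) ge0_ler_powR ?nnegrE ?(ltW hexp_gt0) ?(ltW (base_gt0 j))//.
rewrite ler_pdivrMr// mul1r (@le_trans _ _ 1) ?ler1n//.
by rewrite exprn_ile1// ?time_le1// ltW// time_gt0.
Qed.

Lemma scl_le_time j : scl j <= time j.
Proof.
have t0 := time_gt0 j; have t1 := time_le1 j.
apply: (@le_trans _ _ ((time j ^+ 2) `^ hexp)).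
  rewrite ge0_ler_powR ?nnegrE ?(ltW hexp_gt0) ?(ltW (base_gt0 j)) ?sqr_ge0//.
  rewrite ler_pdivrMr// -[leLHS]mulr1 ler_pM ?exprn_ge0 ?(ltW t0) ?ler1n//.
  by rewrite -[leRHS]mulr1 (exprD _ 2 3) ler_wpM2l ?sqr_ge0// exprn_ile1// ltW.
rewrite -powR_mulrn ?(ltW t0)// -powRrM -[leRHS](powRr1 (ltW t0)).
rewrite ger_powR ?t0//.
have h : 0 < 2 * (1 - alpha) by have := alpha_lt; lra.
by rewrite /hexp mulrA mulr1 ler_pdivlMr//; have := alpha_ge0; lra.
Qed.

Lemma amp_le1 j : amp j <= 1 / 2.
Proof.
rewrite ler_pM2r ?invr_gt0// -(one_powR alpha) ge0_ler_powR ?nnegrE//.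
  exact/ltW/scl_gt0.
exact: scl_le1.
Qed.

Lemma rate_sqr j : rate j ^+ 2 = dur j ^+ 2 * j.+1%:R / (4 * time j ^+ 5).
Proof.
have b0 := base_gt0 j.
have -> : rate j = dur j / 2 * scl j `^ (alpha - 1).
  rewrite /rate /amp powRB; last by apply/implyP => _; rewrite gt_eqF ?scl_gt0.
  by rewrite powRr1 ?ltW ?scl_gt0//; field; rewrite gt_eqF ?scl_gt0.
rewrite exprMn -[in X in _ * X = _]powR_mulrn ?powR_ge0// /scl -!powRrM.
have -> : hexp * ((alpha - 1) * 2) = - 1.
  by have := alpha_lt; rewrite /hexp => h; field; lra.
rewrite powR_inv1 ?ltW//; have tz : time j != 0 by rewrite gt_eqF ?time_gt0.
by field; rewrite nat1r pnatr_eq0 tz.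
Qed.

Lemma rate_sqr_le j : rate j ^+ 2 <= logstep j / j.+1%:R.
Proof.
rewrite rate_sqr; have t0 := time_gt0 j.
have tz : time j != 0 by rewrite gt_eqF.
have -> : logstep j = (time j)^-1 by rewrite /time invrK.
rewrite ler_pdivrMr ?mulr_gt0 ?exprn_gt0//.
have : dur j ^+ 2 <= (time j ^+ 2 / j.+1%:R) ^+ 2.
  rewrite lerXn2r ?nnegrE ?dur_le//; first exact/ltW/dur_gt0.
  by rewrite ltW// divr_gt0// exprn_gt0.
rewrite -(ler_pM2r (_ : 0 < j.+1%:R)) // => /le_trans; apply.
rewrite [leLHS](_ : _ = time j ^+ 4 / j.+1%:R); last first.
  by field; rewrite nat1r pnatr_eq0.
rewrite [leRHS](_ : _ = 4 * (time j ^+ 4 / j.+1%:R)); last first.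
  by field; rewrite nat1r pnatr_eq0 tz.
by rewrite ler_peMl ?ler1n// divr_ge0 ?exprn_ge0 ?ltW.
Qed.

Lemma near_rate_le (a : R) : 0 < a -> \forall j \near \oo, rate j <= a.
Proof.
move=> a0; near=> j.
rewrite -(ler_pXn2r (_ : 0 < 2)%N) ?nnegrE ?(ltW (rate_gt0 j)) ?(ltW a0)//.
apply: (le_trans (rate_sqr_le j)).
have h12 : 0 < 2^-1 :> R by rewrite invr_gt0.
have := @logstep_le_powR 2^-1 j h12; rewrite invrK powR12_sqrt// => h.
rewrite ler_pdivrMr//; apply: (le_trans h).
have [/ltW s0 sj] : 0 < Num.sqrt j.+1%:R :> R /\
    j.+1%:R = Num.sqrt j.+1%:R ^+ 2 :> R.
  by rewrite sqrtr_gt0 sqr_sqrtr.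
rewrite [in leRHS]sj [in leRHS]expr2 mulrA ler_wpM2r//.
have aa : 0 < a * a by rewrite mulr_gt0.
rewrite -ler_pdivrMl//.
rewrite -(ler_pXn2r (_ : 0 < 2)%N) ?nnegrE -?sj//; last first.
  by apply: mulr_ge0 => //; rewrite invr_ge0 ltW.
by near: j; exact: near_natS_ge.
Unshelve. all: by end_near. Qed.

(** The scales decrease so slowly that the contraction of the mean inverse
    distance during one step beats the change of scale.  Up to constants
    [scl j.+1 / scl j] is at least [1 - 6 / j.+1%:R], and the factor [time j ^+ 5]
    in [scl] makes [rate j ^+ 2] exceed [j.+1%:R^-1] by a factor of order
    [logstep j]. *)
Lemma near_sclS_ge (c : R) : 0 < c ->
  \forall j \near \oo, scl j * (1 - c * rate j ^+ 2) <= scl j.+1.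
Proof.
move=> c0; near=> j.
have j0 : (0 < j)%N by near: j; exact: nbhs_infty_gt.
have n0 : 0 < j.+1%:R :> R by [].
have t0 := time_gt0 j; have tz : time j != 0 by rewrite gt_eqF.
set b := time j ^+ 5 / j.+1%:R; set b' := time j.+1 ^+ 5 / j.+2%:R.
have [bp bp'] : 0 < b /\ 0 < b' by split; exact: base_gt0.
have q0 : 0 < b' / b by exact: divr_gt0.
have q1 : b' / b <= 1.
  rewrite ler_pdivrMr// mul1r; apply: ler_pM.
  - by rewrite exprn_ge0// ltW ?time_gt0.
  - by rewrite invr_ge0.
  - by rewrite lerXn2r ?nnegrE ?(ltW (time_gt0 _))// ltW// timeS_lt.
  - by rewrite lef_pV2 ?posrE// ler_nat.
have -> : scl j.+1 = scl j * (b' / b) `^ hexp.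
  rewrite /scl -powRM ?ltW// -/b -/b'; congr (_ `^ _).
  by rewrite mulrCA mulfV ?mulr1// gt_eqF.
rewrite ler_pM2l ?scl_gt0//.
have : b' / b <= (b' / b) `^ hexp by rewrite ger1_powR ?q0// hexp_le1.
apply: le_trans.
pose x : R := j.+1%:R^-1.
have x0 : 0 < x by rewrite invr_gt0.
have x1 : x <= 1 by rewrite invf_le1// ler1n.
have hq : (1 - x) ^+ 6 <= b' / b.
  have -> : b' / b = (time j.+1 / time j) ^+ 5 * (j.+1%:R / j.+2%:R).
    have n1 : j.+1%:R != 0 :> R by rewrite pnatr_eq0.
    have n2 : j.+2%:R != 0 :> R by rewrite pnatr_eq0.
    rewrite /b /b'; move: tz n1 n2; move: (time j) (time j.+1).
    by move: j.+1%:R j.+2%:R => n m t t' tz nz mz; field; rewrite tz nz mz.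
  rewrite exprSr; apply: ler_pM; rewrite ?exprn_ge0 ?subr_ge0//.
    rewrite lerXn2r ?nnegrE ?subr_ge0//; last by rewrite ler_pdivlMr// timeS_ge.
    by rewrite ltW// divr_gt0// time_gt0.
  rewrite ler_pdivlMr// mulrBl mul1r lerBlDr -natr1 lerD2l /x mulrC.
  by rewrite ler_pdivlMr// mul1r lerDl.
have hb : 1 - 6 * x <= (1 - x) ^+ 6.
  have y0 : 0 <= 1 - x by rewrite subr_ge0.
  have bern n : 1 - n%:R * x <= (1 - x) ^+ n.
    elim: n => [|n IH]; first by rewrite mul0r subr0 expr0.
    rewrite exprS; apply: (@le_trans _ _ ((1 - x) * (1 - n%:R * x))).
      rewrite -natr1; have : 0 <= n%:R * x * x by rewrite !mulr_ge0// ltW.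
      by lra.
    by rewrite ler_wpM2l.
  exact: bern.
apply: (le_trans _ (le_trans hb hq)).
rewrite lerB//.
have : (x / (64 * time j)) <= rate j ^+ 2.
  rewrite rate_sqr ler_pdivlMr ?mulr_gt0 ?exprn_gt0//.
  have := dur_ge j0.
  have d0 : 0 <= time j ^+ 2 / (4 * j.+1%:R).
    by rewrite ltW// divr_gt0 ?exprn_gt0// mulr_gt0.
  rewrite -(ler_pXn2r (_ : 0 < 2)%N) ?nnegrE ?(ltW (dur_gt0 j))//.
  rewrite -(ler_pM2r n0); apply: le_trans.
  rewrite /x le_eqVlt; apply/orP; left; apply/eqP.
  by field; rewrite nat1r pnatr_eq0 tz.
move=> /(ler_wpM2l (ltW c0)) hr; apply: (le_trans _ hr).
rewrite [leRHS](_ : _ = (c / 64 * logstep j) * x); last first.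
  by rewrite /time; field; rewrite gt_eqF ?logstep_gt0.
rewrite ler_pM2r// mulrC -ler_pdivrMr ?divr_gt0//.
by near: j; exact: near_logstep_ge.
Unshelve. all: by end_near. Qed.

(** During one step a [beta]-Hoelder path moves much less than the scale,
    because [dur j] is at most [j.+1%:R^-1] and [scl j] is the power [- hexp] of
    [j.+1%:R] up to powers of [logstep j]. *)
Lemma near_dur_powR_le (beta a : R) : hexp < beta -> 0 < a ->
  \forall j \near \oo, dur j `^ beta <= a * scl j.
Proof.
move=> hb a0.
have k0 := hexp_gt0; have k1 := hexp_le1.
(* Half of the gap between the exponents pays for the five powers of
   [logstep j], the other half makes the quotient tend to zero. *)
pose e := (beta - hexp) / 10.
have e0 : 0 < e by rewrite divr_gt0// subr_gt0.
have C0 : 0 < 1 + e^-1 by rewrite addr_gt0// invr_gt0.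
near=> j.
set n : R := j.+1%:R; have n0 : 0 < n by rewrite /n.
have n1 : 1 <= n by rewrite /n ler1n.
have hd : dur j `^ beta <= n `^ (- beta).
  rewrite powRN -powR_inv1 ?powR_ge0// -powRrM mulrC powRrM powR_inv1 ?(ltW n0)//.
  rewrite ge0_ler_powR ?nnegrE ?invr_ge0 ?(ltW n0) ?(ltW (dur_gt0 j))//.
    exact/ltW/(lt_trans k0).
  exact: dur_le_inv.
apply: (le_trans hd).
have -> : scl j = n `^ (- hexp) * (logstep j ^+ 5) `^ (- hexp).
  rewrite /scl powRM ?invr_ge0 ?exprn_ge0 ?ltW ?time_gt0// mulrC; congr (_ * _).
    by rewrite -powR_inv1 ?ltW// -powRrM mulN1r.
  by rewrite /time exprVn -powR_inv1 ?exprn_ge0 ?ltW ?logstep_gt0// -powRrM mulN1r.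
have L5 : (logstep j ^+ 5) `^ hexp <= ((1 + e^-1) ^+ 5) * n `^ (e * 5).
  have g1 : 1 <= logstep j ^+ 5 by rewrite exprn_ege1// logstep_ge1.
  apply: (le_trans (ler1_powR _ _)) => //.
  rewrite powRrM -[5]/(5%:R) powR_mulrn ?powR_ge0// -exprMn.
  rewrite ler_pXn2r ?nnegrE ?logstep_le_powR//; first exact/ltW/logstep_gt0.
  by rewrite mulr_ge0 ?powR_ge0 ?ltW.
have Lp : 0 < (logstep j ^+ 5) `^ hexp by rewrite powR_gt0// exprn_gt0// logstep_gt0.
rewrite (powRN (logstep j ^+ 5)) mulrA ler_pdivlMr//.
rewrite mulrC -ler_pdivlMr ?powR_gt0//.
apply: (le_trans L5).
rewrite -[in leRHS]mulrA -powRB; last by apply/implyP => _; rewrite gt_eqF.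
have -> : - hexp - - beta = e * 5 + e * 5 by rewrite /e; lra.
rewrite powRD; last by apply/implyP => _; rewrite gt_eqF.
rewrite mulrA ler_pM2r ?powR_gt0//.
rewrite -ler_pdivrMl//.
have e5 : 0 < e * 5 by rewrite mulr_gt0.
set X := leLHS.
have X0 : 0 <= X by rewrite mulr_ge0 ?invr_ge0 ?exprn_ge0// ltW.
have -> : X = (X `^ (e * 5)^-1) `^ (e * 5).
  by rewrite -powRrM mulVf ?powRr1// gt_eqF.
rewrite ge0_ler_powR ?nnegrE ?powR_ge0 ?(ltW n0) ?(ltW e5)//.
by rewrite /n /X; near: j; exact: near_natS_ge.
Unshelve. all: by end_near. Qed.

End parameters.

(** * Elementary estimates *)

Section elementary.
Context (R : realType).
Implicit Types (x a b m h : R).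

Lemma sinE_mean x : exists2 y, `|y| <= `|x| & sin x = x * cos y.
Proof.
suff pos (z : R) : 0 < z -> exists2 y : R, `|y| <= `|z| & sin z = z * cos y.
  have [xn|xp|->] := ltgtP x 0.
  - have [|y yx e] := pos (- x); first by rewrite oppr_gt0.
    exists y; first by rewrite -(normrN x).
    by apply: oppr_inj; rewrite -sinN e mulNr.
  - exact: pos.
  - by exists 0 => //; rewrite sin0 mul0r.
move=> z0.
have [|y] := @MVT R sin cos 0 z z0 (fun y _ => is_derive_sin y).
  by apply: continuous_subspaceT => y; exact: continuous_sin.
rewrite in_itv/= => /andP[y0 yz]; rewrite sin0 !subr0 mulrC => e.
by exists y => //; rewrite !gtr0_norm// ltW.
Qed.

Lemma sqr_sin_le x : sin x ^+ 2 <= x ^+ 2.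
Proof.
have [y _ ->] := sinE_mean x.
by rewrite exprMn ler_piMr ?sqr_ge0// cos2sin2 gerBl sqr_ge0.
Qed.

Lemma sqr_sin_ge x : x ^+ 2 * (1 - x ^+ 2) <= sin x ^+ 2.
Proof.
have [y yx ->] := sinE_mean x.
rewrite exprMn ler_wpM2l ?sqr_ge0// cos2sin2 lerB//.
apply: (le_trans (sqr_sin_le y)).
by rewrite -(real_normK (num_real y)) -(real_normK (num_real x)) lerXn2r ?nnegrE.
Qed.

(** The squared length of the chord of angle [x] of the unit circle. *)
Definition chord x : R := 2 - 2 * cos x.

Lemma chordE x : chord x = 4 * sin (x / 2) ^+ 2.
Proof.
rewrite /chord {1}(_ : x = (x / 2) *+ 2); last by rewrite -mulr_natr divfK.
by rewrite cos_mulr2n cos2sin2; ring.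
Qed.

Lemma chordB a b : (cos a - cos b) ^+ 2 + (sin a - sin b) ^+ 2 = chord (a - b).
Proof.
rewrite /chord cosB; have := cos2Dsin2 a; have := cos2Dsin2 b => eb ea.
rewrite [LHS](_ : _ = (cos a ^+ 2 + sin a ^+ 2) + (cos b ^+ 2 + sin b ^+ 2) -
  2 * (cos a * cos b + sin a * sin b)); last by ring.
by rewrite ea eb; ring.
Qed.

Lemma chord_ge0 x : 0 <= chord x.
Proof. by rewrite chordE mulr_ge0// sqr_ge0. Qed.

Lemma chord_le x : chord x <= x ^+ 2.
Proof. by rewrite chordE; have := sqr_sin_le (x / 2); lra. Qed.

Lemma chord_ge x : `|x| <= 1 / 16 -> 15 / 16 * x ^+ 2 <= chord x.
Proof.
move=> hx; rewrite chordE; have := sqr_sin_ge (x / 2).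
have : x ^+ 2 <= (1 / 16) ^+ 2.
  by rewrite -(real_normK (num_real x)) lerXn2r ?nnegrE// divr_ge0.
have := sqr_ge0 x; nra.
Qed.

Lemma norm_cosB_le a b : `|cos a - cos b| <= `|a - b|.
Proof.
rewrite -(ler_pXn2r (_ : 0 < 2)%N) ?nnegrE// !real_normK ?num_real//.
apply: (le_trans _ (chord_le _)); rewrite -chordB lerDl sqr_ge0//.
Qed.

Lemma norm_sinB_le a b : `|sin a - sin b| <= `|a - b|.
Proof.
rewrite -(ler_pXn2r (_ : 0 < 2)%N) ?nnegrE// !real_normK ?num_real//.
apply: (le_trans _ (chord_le _)); rewrite -chordB lerDr sqr_ge0//.
Qed.

Lemma cos_ge_sqr x : 1 - x ^+ 2 / 2 <= cos x.
Proof. by have := chord_le x; rewrite /chord; lra. Qed.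

(** The cubic remainder is positive so that squaring both sides gives a
    polynomial inequality, with the sign of [x] as the only case distinction. *)
Lemma inv_sqrt_taylor x : `|x| <= 1 / 2 ->
  (Num.sqrt (1 + x))^-1 <= 1 - x / 2 + 3 / 8 * x ^+ 2 + `|x| ^+ 3.
Proof.
move=> hx; have /andP[x1 x2] : - (1 / 2) <= x <= 1 / 2 by rewrite -ler_norml.
have p0 : 0 < 1 + x by lra.
have s0 : 0 < Num.sqrt (1 + x) by rewrite sqrtr_gt0.
set T := leRHS.
have T0 : 0 <= T.
  have := sqr_ge0 x; have : 0 <= `|x| ^+ 3 by rewrite exprn_ge0.
  by rewrite /T; lra.
rewrite -[leLHS]mul1r ler_pdivrMr//.
rewrite -(ler_pXn2r (_ : 0 < 2)%N) ?nnegrE ?mulr_ge0 ?(ltW s0)//.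
rewrite exprMn sqr_sqrtr ?(ltW p0)// expr1n.
pose p := 1 - x / 2 + 3 / 8 * x ^+ 2.
have pE : p ^+ 2 * (1 + x) = 1 + x ^+ 3 * (5 / 8 - 15 / 64 * x + 9 / 64 * x ^+ 2).
  by rewrite /p; field.
have [x0|x0] := leP 0 x.
  have Tp : p ^+ 2 <= T ^+ 2.
    rewrite lerXn2r ?nnegrE//; last by rewrite /T lerDl exprn_ge0.
    by rewrite /p addr_ge0 ?mulr_ge0 ?divr_ge0 ?sqr_ge0//; lra.
  apply: (le_trans _ (ler_wpM2r (ltW p0) Tp)); rewrite pE lerDl.
  rewrite mulr_ge0 ?exprn_ge0// addr_ge0 ?mulr_ge0 ?divr_ge0 ?sqr_ge0//; lra.
have p1 : 1 <= p by rewrite /p; have := sqr_ge0 x; lra.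
have y0 : 0 <= - x ^+ 3 by rewrite oppr_ge0 exprS mulr_le0_ge0 ?sqr_ge0 ?ltW.
have TE : T = p - x ^+ 3 by rewrite /T ltr0_norm// /p; ring.
have : p ^+ 2 + 2 * (- x ^+ 3) <= T ^+ 2 by rewrite TE; nra.
move=> /(ler_wpM2r (ltW p0)); apply: le_trans.
rewrite mulrDl pE.
have -> : 1 + x ^+ 3 * (5 / 8 - 15 / 64 * x + 9 / 64 * x ^+ 2) +
   2 * - x ^+ 3 * (1 + x) =
   1 + (- x ^+ 3) * (11 / 8 + 143 / 64 * x - 9 / 64 * x ^+ 2) by field.
rewrite lerDl mulr_ge0//; nra.
Qed.

(** Second-order expansion of the inverse distance, averaged over a
    displacement [+- eta * e] so that the odd terms cancel;
    [X = eta (e . delta) / |delta|^2] and [Y = eta^2 |e|^2 / |delta|^2]. *)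
Lemma inv_sqrt_pm (X Y h : R) : 0 <= h <= 1 / 8 -> `|X| <= h -> 0 <= Y <= h ^+ 2 ->
  (Num.sqrt (1 + (Y + 2 * X)))^-1 + (Num.sqrt (1 + (Y - 2 * X)))^-1 <=
  2 - Y + 3 * X ^+ 2 + 56 * h ^+ 3.
Proof.
move=> /andP[h0 h1] hX /andP[Y0 hY].
have /andP[X1 X2] : - h <= X <= h by rewrite -ler_norml.
have hh : h ^+ 2 <= h by rewrite expr2; nra.
have b1 : `|Y + 2 * X| <= 3 * h by rewrite ler_norml; apply/andP; split; lra.
have b2 : `|Y - 2 * X| <= 3 * h by rewrite ler_norml; apply/andP; split; lra.
have c3 (z : R) : `|z| <= 3 * h -> `|z| ^+ 3 <= 27 * h ^+ 3.
  move=> hz; rewrite (_ : 27 * _ = (3 * h) ^+ 3); last by ring.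
  by rewrite lerXn2r ?nnegrE// mulr_ge0.
have t1 := @inv_sqrt_taylor (Y + 2 * X).
have t2 := @inv_sqrt_taylor (Y - 2 * X).
apply: (le_trans (lerD (t1 _) (t2 _))); [lra|lra|].
apply: (@le_trans _ _ (2 - Y + 3 * X ^+ 2 + 3 / 4 * Y ^+ 2 +
   (`|Y + 2 * X| ^+ 3 + `|Y - 2 * X| ^+ 3))).
  by rewrite le_eqVlt; apply/orP; left; apply/eqP; field.
have := c3 _ b1; have := c3 _ b2.
have : Y ^+ 2 <= h ^+ 3.
  rewrite expr2 (_ : h ^+ 3 = h ^+ 2 * h); last by ring.
  by rewrite ler_pM// (le_trans hY).
have : 0 <= h ^+ 3 by rewrite exprn_ge0.
lra.
Qed.


(** * The inverse distance contracts on average under random shears *)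

(** Four wave vectors [k] and, for each, a direction [e] orthogonal to [k] with
    [|k| |e| = 1].  Two orthogonal directions would not do: on the
    diagonals the mean inverse distance would then grow. *)
Definition kdot (d : nat) (x : 'rV[R]_2) : R :=
  match d with
  | 0 => x 0 1
  | 1 => x 0 0
  | 2 => x 0 0 + x 0 1
  | _ => x 0 0 - x 0 1
  end.

Definition edir (d : nat) : 'rV[R]_2 :=
  match d with
  | 0 => \row_i (i == 0)%:R
  | 1 => \row_i (i == 1)%:R
  | 2 => \row_i (if i == 0 then 1 / 2 else - (1 / 2))
  | _ => \row_i (1 / 2)
  end.

Definition dot (x y : 'rV[R]_2) : R := x 0 0 * y 0 0 + x 0 1 * y 0 1.

Definition sqn (x : 'rV[R]_2) : R := dot x x.

Lemma sqnE (x : 'rV[R]_2) : sqn x = x 0 0 ^+ 2 + x 0 1 ^+ 2.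
Proof. by rewrite /sqn /dot !expr2. Qed.

Lemma sqn_ge0 (x : 'rV[R]_2) : 0 <= sqn x.
Proof. by rewrite sqnE addr_ge0// sqr_ge0. Qed.

Lemma eucl_normE (x : 'rV[R]_2) : eucl_norm x = Num.sqrt (sqn x).
Proof.
rewrite /eucl_norm sqnE !big_ord_recl big_ord0 addr0.
by congr (Num.sqrt (_ + x 0 _ ^+ 2)); apply: val_inj.
Qed.

Lemma edirE d : (edir d 0 0 = match d with 0 => 1 | 1 => 0 | _ => 1 / 2 end) *
  (edir d 0 1 = match d with 0 => 0 | 1 => 1 | 2 => - (1 / 2) | _ => 1 / 2 end).
Proof. by move: d => [|[|[|d]]]; rewrite !mxE. Qed.

Lemma kdotD d (x y : 'rV[R]_2) : kdot d (x + y) = kdot d x + kdot d y.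
Proof. by move: d => [|[|[|d]]]; rewrite /kdot !mxE//; ring. Qed.

Lemma kdotZ d a (x : 'rV[R]_2) : kdot d (a *: x) = a * kdot d x.
Proof. by move: d => [|[|[|d]]]; rewrite /kdot !mxE//; ring. Qed.

Lemma kdotB d (x y : 'rV[R]_2) : kdot d (x - y) = kdot d x - kdot d y.
Proof. by rewrite -scaleN1r kdotD kdotZ mulN1r. Qed.

Lemma kdot_edir d : kdot d (edir d) = 0.
Proof. by move: d => [|[|[|d]]]; rewrite /kdot !edirE//; ring. Qed.

Lemma sqn_edir_le1 d : sqn (edir d) <= 1.
Proof. by move: d => [|[|[|d]]]; rewrite sqnE !edirE; lra. Qed.

Lemma kdot_le d (x : 'rV[R]_2) : sqn (edir d) * kdot d x ^+ 2 <= sqn x.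
Proof.
have := sqr_ge0 (x 0 0); have := sqr_ge0 (x 0 1).
have := sqr_ge0 (x 0 0 - x 0 1); have := sqr_ge0 (x 0 0 + x 0 1).
by move: d => [|[|[|d]]]; rewrite !sqnE !edirE /kdot; lra.
Qed.

Lemma sqr_kdot_le d (x : 'rV[R]_2) : kdot d x ^+ 2 <= 2 * sqn x.
Proof.
have := sqr_ge0 (x 0 0); have := sqr_ge0 (x 0 1).
have := sqr_ge0 (x 0 0 - x 0 1); have := sqr_ge0 (x 0 0 + x 0 1).
by move: d => [|[|[|d]]]; rewrite !sqnE /kdot; lra.
Qed.

Lemma sqr_dot_le (x y : 'rV[R]_2) : dot x y ^+ 2 <= sqn x * sqn y.
Proof.
rewrite /sqn /dot -subr_ge0 (_ : _ - _ = (x 0 0 * y 0 1 - x 0 1 * y 0 0) ^+ 2).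
  exact: sqr_ge0.
by ring.
Qed.

Lemma sqn_shift (x e : 'rV[R]_2) a :
  sqn (x + a *: e) = sqn x + 2 * a * dot e x + a ^+ 2 * sqn e.
Proof. by rewrite /sqn /dot !mxE; ring. Qed.

Lemma sqn_eq0 (x : 'rV[R]_2) : (sqn x == 0) = (x == 0).
Proof.
apply/eqP/eqP => [|->]; last by rewrite sqnE !mxE; ring.
rewrite sqnE => /eqP; rewrite paddr_eq0 ?sqr_ge0// !sqrf_eq0.
move=> /andP[/eqP x0 /eqP x1]; apply/rowP => i; rewrite mxE.
by case: i => [[|[|]]]// ?; [rewrite -[RHS]x0|rewrite -[RHS]x1]; congr (x _ _); apply: val_inj.
Qed.

(** Four phases, each a quarter of a period apart, displace the difference of two
    points by [+- eta1] and [+- eta2] along [e].  Only the sum of the squares of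
    these numbers enters at second order, and this sum does not depend on the
    position of the two points. *)
Lemma inv_norm_shift4 (x e : 'rV[R]_2) (eta1 eta2 q h : R) :
    x != 0 -> 0 <= h <= 1 / 8 -> eta1 ^+ 2 + eta2 ^+ 2 = q ->
    q * sqn e <= h ^+ 2 * sqn x ->
  (eucl_norm (x + eta1 *: e))^-1 + (eucl_norm (x + eta2 *: e))^-1 +
  (eucl_norm (x + (- eta1) *: e))^-1 + (eucl_norm (x + (- eta2) *: e))^-1 <=
  (eucl_norm x)^-1 * (4 + q * (3 * dot e x ^+ 2 - sqn e * sqn x) / sqn x ^+ 2
    + 112 * h ^+ 3).
Proof.
move=> x0 /andP[h0 h1] qE qh.
have s0 : 0 < sqn x by rewrite lt_neqAle eq_sym sqn_eq0 x0 sqn_ge0.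
have sz : sqn x != 0 by rewrite gt_eqF.
suff two (eta : R) : eta ^+ 2 <= q ->
    (eucl_norm (x + eta *: e))^-1 + (eucl_norm (x + (- eta) *: e))^-1 <=
    (eucl_norm x)^-1 * (2 + eta ^+ 2 * (3 * dot e x ^+ 2 - sqn e * sqn x) /
      sqn x ^+ 2 + 56 * h ^+ 3).
  have t1 := two eta1; have t2 := two eta2.
  rewrite -addrA addrACA.
  apply: (le_trans (lerD (t1 _) (t2 _))).
  - by rewrite -qE lerDl sqr_ge0.
  - by rewrite -qE lerDr sqr_ge0.
  - by rewrite -mulrDr le_eqVlt -qE; apply/orP; left; apply/eqP; congr (_ * _); field.
move=> etaq.
pose X : R := eta * dot e x / sqn x; pose Y : R := eta ^+ 2 * sqn e / sqn x.
have Y0 : 0 <= Y by apply: divr_ge0; rewrite ?sqn_ge0// mulr_ge0 ?sqr_ge0 ?sqn_ge0.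
have Yh : Y <= h ^+ 2.
  rewrite ler_pdivrMr//; apply: le_trans qh.
  by rewrite ler_wpM2r ?sqn_ge0.
have XY : X ^+ 2 <= Y.
  rewrite /X /Y exprMn exprVn exprMn ler_pdivrMr ?exprn_gt0//.
  rewrite (_ : _ / _ * _ = eta ^+ 2 * (sqn e * sqn x)); last by field.
  by rewrite ler_wpM2l ?sqr_ge0 ?sqr_dot_le.
have Xh : `|X| <= h.
  rewrite -(ler_pXn2r (_ : 0 < 2)%N) ?nnegrE// real_normK ?num_real//.
  exact: le_trans XY Yh.
have nE s : eucl_norm (x + s *: e) =
    Num.sqrt (sqn x) * Num.sqrt (1 + (s ^+ 2 * sqn e / sqn x + 2 * (s * dot e x / sqn x))).
  rewrite eucl_normE -sqrtrM ?sqn_ge0// sqn_shift; congr Num.sqrt.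
  by field.
rewrite !nE sqrrN -/Y -/X (_ : 2 * (- eta * _ / _) = - (2 * X)); last first.
  by rewrite /X; ring.
rewrite !invfM -mulrDr eucl_normE ler_wpM2l ?invr_ge0 ?sqrtr_ge0//.
have := @inv_sqrt_pm X Y h; rewrite h0 h1 Y0 Yh => /(_ isT Xh isT).
move=> /le_trans; apply.
rewrite le_eqVlt; apply/orP; left; apply/eqP.
by rewrite /X /Y; field.
Qed.

Lemma sum4 (F : nat -> R) : \sum_(d < 4) F d = F 0%N + F 1%N + F 2%N + F 3%N.
Proof. by rewrite !big_ord_recr big_ord0 /= add0r. Qed.

(** The second derivative of [1 / |x|] in the direction [edir d], times
    [|x| ^+ 5]. *)
Definition dirgain d (x : 'rV[R]_2) : R :=
  3 * dot (edir d) x ^+ 2 - sqn (edir d) * sqn x.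

(** Far from each other two points see unrelated velocities; this crude bound
    then suffices. *)
Lemma dirgain_large (q : nat -> R) (h : R) (x : 'rV[R]_2) :
  (forall d, 0 <= q d <= h ^+ 2 * kdot d x ^+ 2) ->
  \sum_(d < 4) q d * dirgain d x <= 3 / 2 * h ^+ 2 * sqn x ^+ 2.
Proof.
move=> hq.
have b d : q d * dirgain d x <= h ^+ 2 * (3 * kdot d x ^+ 2 * dot (edir d) x ^+ 2).
  have /andP[q0 q1] := hq d.
  apply: (@le_trans _ _ (q d * (3 * dot (edir d) x ^+ 2))).
    by rewrite ler_wpM2l// gerBl mulr_ge0// sqn_ge0.
  apply: (le_trans (ler_wpM2r _ q1)); first by rewrite mulr_ge0// sqr_ge0.
  by rewrite le_eqVlt; apply/orP; left; apply/eqP; ring.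
apply: (@le_trans _ _ (\sum_(d < 4)
    h ^+ 2 * (3 * kdot d x ^+ 2 * dot (edir d) x ^+ 2))).
  by apply: ler_sum => d _; exact: b.
rewrite (sum4 (fun d => h ^+ 2 * (3 * kdot d x ^+ 2 * dot (edir d) x ^+ 2))).
rewrite /kdot /dot !edirE /= sqnE.
by rewrite le_eqVlt; apply/orP; left; apply/eqP; field.
Qed.

(** The four directions make the sum isotropic: if [c] and [s] are the cosine and
    sine of the angle between [x] and the direction, then [s^2 (3 c^2 - 1)] adds
    up to [- 1 / 2] for every [x].  The margin absorbs the factor [7 / 8]. *)
Lemma dirgain_small (q : nat -> R) (h : R) (x : 'rV[R]_2) :
  (forall d, 7 / 8 * (h ^+ 2 * kdot d x ^+ 2) <= q d <= h ^+ 2 * kdot d x ^+ 2) ->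
  \sum_(d < 4) q d * dirgain d x <= - (1 / 4) * h ^+ 2 * sqn x ^+ 2.
Proof.
move=> hq.
have b d : q d * dirgain d x <= h ^+ 2 * kdot d x ^+ 2 *
    (3 * dot (edir d) x ^+ 2 - 7 / 8 * (sqn (edir d) * sqn x)).
  have /andP[q0 q1] := hq d; rewrite /dirgain.
  have : 0 <= dot (edir d) x ^+ 2 by exact: sqr_ge0.
  have : 0 <= sqn (edir d) * sqn x by rewrite mulr_ge0// sqn_ge0.
  move: q0 q1; set Q := h ^+ 2 * _; set m := _ ^+ 2; set n := sqn _ * _.
  by move=> q0 q1 n0 m0; nra.
apply: (@le_trans _ _ (\sum_(d < 4) h ^+ 2 * kdot d x ^+ 2 *
    (3 * dot (edir d) x ^+ 2 - 7 / 8 * (sqn (edir d) * sqn x)))).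
  by apply: ler_sum => d _; exact: b.
rewrite (sum4 (fun d => h ^+ 2 * kdot d x ^+ 2 *
  (3 * dot (edir d) x ^+ 2 - 7 / 8 * (sqn (edir d) * sqn x)))).
rewrite /kdot /dot !sqnE !edirE /=.
by rewrite le_eqVlt; apply/orP; left; apply/eqP; field.
Qed.

End elementary.

Section shift.
Context (R : realType).
Implicit Types (x y z : 'rV[R]_2) (C S a l : R) (d q r : nat).

Definition prof q (theta : R) : R :=
  match q with
  | 0 => cos theta | 1 => sin theta | 2 => - cos theta | _ => - sin theta
  end.

(** [rprof C S q] is the combination of translates of [prof q] obtained by
    integrating [w |-> prof q (theta + w)] along a path, if [C] and [S] are the
    integrals of the cosine and of the sine along this path. *)
Definition rprof C S q (theta : R) : R :=
  match q with
  | 0 => C * cos theta - S * sin theta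
  | 1 => C * sin theta + S * cos theta
  | 2 => - (C * cos theta - S * sin theta)
  | _ => - (C * sin theta + S * cos theta)
  end.

Lemma prof_le1 q (theta : R) : `|prof q theta| <= 1.
Proof. by move: q => [|[|[|q]]]; rewrite /prof ?normrN ?cos_max ?sin_max. Qed.

Lemma prof_lip q (s t : R) : `|prof q s - prof q t| <= `|s - t|.
Proof.
move: q => [|[|[|q]]]; rewrite /prof ?norm_cosB_le ?norm_sinB_le//.
  by rewrite -opprD normrN norm_cosB_le.
by rewrite -opprD normrN norm_sinB_le.
Qed.

Lemma profD q (theta w : R) : prof q (theta + w) = rprof (cos w) (sin w) q theta.
Proof.
by move: q => [|[|[|q]]]; rewrite /prof /rprof ?cosD ?sinD; ring.
Qed.

Lemma sqr_rprof_le C S q (theta : R) : rprof C S q theta ^+ 2 <= C ^+ 2 + S ^+ 2.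
Proof.
have cs := cos2Dsin2 theta; rewrite -[leRHS]mulr1 -cs.
have h1 : (C * cos theta - S * sin theta) ^+ 2 <=
  (C ^+ 2 + S ^+ 2) * (cos theta ^+ 2 + sin theta ^+ 2).
  rewrite -subr_ge0 (_ : _ - _ = (C * sin theta + S * cos theta) ^+ 2).
    exact: sqr_ge0.
  by ring.
have h2 : (C * sin theta + S * cos theta) ^+ 2 <=
  (C ^+ 2 + S ^+ 2) * (cos theta ^+ 2 + sin theta ^+ 2).
  rewrite -subr_ge0 (_ : _ - _ = (C * cos theta - S * sin theta) ^+ 2).
    exact: sqr_ge0.
  by ring.
by move: q => [|[|[|q]]]; rewrite /rprof ?sqrrN.
Qed.

(** A digit [r < 16] encodes one of four directions and one of four phases. *)
Definition dir r := (r %/ 4)%N.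
Definition phase r := (r %% 4)%N.

(** The displacement caused by a shear flow of amplitude [a] and scale [l] along
    a path whose trigonometric integrals are [CS]. *)
Definition disp a l (CS : nat -> R * R) r x : 'rV[R]_2 :=
  (a * rprof (CS (dir r)).1 (CS (dir r)).2 (phase r) (kdot (dir r) x / l))
    *: edir R (dir r).

Definition shift a l CS r x := x + disp a l CS r x.

Definition unshift a l CS r x := x - disp a l CS r x.

(** A shear does not change the phase that drives it; hence the explicit
    inverse. *)
Lemma dispD_edir a l CS r x (b : R) :
  disp a l CS r (x + b *: edir R (dir r)) = disp a l CS r x.
Proof. by rewrite /disp kdotD kdotZ kdot_edir mulr0 addr0. Qed.

Lemma unshiftK a l CS r : cancel (unshift a l CS r) (shift a l CS r).
Proof.
move=> x; rewrite /shift /unshift.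
by rewrite [disp _ _ _ _ (_ - _)](_ : _ = disp a l CS r x) ?subrK// {2}/disp -scaleNr dispD_edir.
Qed.

Lemma shiftK a l CS r : cancel (shift a l CS r) (unshift a l CS r).
Proof.
move=> x; rewrite /shift /unshift.
by rewrite [disp _ _ _ _ (_ + _)](_ : _ = disp a l CS r x) ?addrK// {2}/disp dispD_edir.
Qed.

Lemma norm_edir_le1 d i : `|edir R d 0 i| <= 1.
Proof.
rewrite -(ler_pXn2r (_ : 0 < 2)%N) ?nnegrE// real_normK ?num_real// expr1n.
apply: le_trans (sqn_edir_le1 R d); rewrite sqnE.
by case: i => [[|[|]]]// ?; [apply: (@le_trans _ _ (edir R d 0 0 ^+ 2));
  [|by rewrite lerDl sqr_ge0]|apply: (@le_trans _ _ (edir R d 0 1 ^+ 2));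
  [|by rewrite lerDr sqr_ge0]]; rewrite le_eqVlt; apply/orP; left; apply/eqP;
  congr (edir R d _ _ ^+ 2); apply: val_inj.
Qed.

Lemma disp_le a l CS r x i (tau : R) : 0 <= a <= 1 -> 0 <= tau ->
  (CS (dir r)).1 ^+ 2 + (CS (dir r)).2 ^+ 2 <= tau ^+ 2 ->
  `|disp a l CS r x 0 i| <= tau.
Proof.
move=> /andP[a0 a1] t0 ht; rewrite /disp mxE !normrM.
rewrite -[leRHS]mulr1 ler_pM ?norm_edir_le1//.
rewrite -[leRHS]mul1r ler_pM//; first by rewrite ger0_norm.
rewrite -(ler_pXn2r (_ : 0 < 2)%N) ?nnegrE// real_normK ?num_real//.
exact: le_trans (sqr_rprof_le _ _ _ _) ht.
Qed.

Lemma sum16 (F : nat -> R) :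
  \sum_(r < 16) F r =
  \sum_(d < 4) (F (d * 4 + 0)%N + F (d * 4 + 1)%N + F (d * 4 + 2)%N + F (d * 4 + 3)%N).
Proof. by rewrite !big_ord_recr !big_ord0 /=; ring. Qed.

(** The one-step estimate.  While the two points are much closer than the scale
    [l], the chord is comparable with the angle and the isotropy of the four
    directions makes the mean of the inverse distance contract; otherwise the
    inverse distance is at most [32 / l], and the additive term pays for its
    possible growth. *)
Lemma inv_dist_shift_avg a l (tau h : R) (CS : nat -> R * R) x y :
    0 < a -> 0 < l -> 0 < tau -> h = a * tau / l -> h <= 1 / 4000 ->
    (forall d, 15 / 16 * tau ^+ 2 <= (CS d).1 ^+ 2 + (CS d).2 ^+ 2 <= tau ^+ 2) ->
    x != y ->
  (\sum_(r < 16) (eucl_norm (shift a l CS r x - shift a l CS r y))^-1) / 16 <=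
  (1 - h ^+ 2 / 128) * (eucl_norm (x - y))^-1 + 64 * h ^+ 2 / l.
Proof.
move=> a0 l0 t0 hE hle hCS xy.
have h0 : 0 < h by rewrite hE divr_gt0// mulr_gt0.
set z := x - y.
have z0 : z != 0 by rewrite subr_eq0.
have s0 : 0 < sqn z by rewrite lt_neqAle eq_sym sqn_eq0 z0 sqn_ge0.
pose q d := a ^+ 2 * ((CS d).1 ^+ 2 + (CS d).2 ^+ 2) * chord (kdot d z / l).
have hk d : a ^+ 2 * tau ^+ 2 * (kdot d z / l) ^+ 2 = h ^+ 2 * kdot d z ^+ 2.
  by rewrite hE; field; rewrite gt_eqF.
have q0 d : 0 <= q d.
  by rewrite /q mulr_ge0 ?chord_ge0// mulr_ge0 ?sqr_ge0// addr_ge0 ?sqr_ge0.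
have q1 d : q d <= h ^+ 2 * kdot d z ^+ 2.
  have /andP[_ c1] := hCS d.
  rewrite -hk /q; apply: ler_pM; rewrite ?chord_ge0 ?chord_le//.
    by rewrite mulr_ge0 ?sqr_ge0// addr_ge0 ?sqr_ge0.
  by rewrite ler_wpM2l ?sqr_ge0.
pose F r : R := (eucl_norm (shift a l CS r x - shift a l CS r y))^-1.
set V := (eucl_norm z)^-1.
have V0 : 0 < V by rewrite invr_gt0 eucl_normE sqrtr_gt0.
have FE d : F (d * 4 + 0)%N + F (d * 4 + 1)%N + F (d * 4 + 2)%N + F (d * 4 + 3)%N <=
    V * (4 + q d * dirgain d z / sqn z ^+ 2 + 112 * h ^+ 3).
  have dirE k : (k < 4)%N -> dir (d * 4 + k) = d.
    by move=> k4; rewrite /dir divnMDl// divn_small// addn0.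
  have phE k : (k < 4)%N -> phase (d * 4 + k) = k.
    by move=> k4; rewrite /phase modnMDl modn_small.
  rewrite /F /shift /disp !dirE// !phE//.
  pose eta k := a * (rprof (CS d).1 (CS d).2 k (kdot d x / l) -
    rprof (CS d).1 (CS d).2 k (kdot d y / l)).
  have dE k : x + (a * rprof (CS d).1 (CS d).2 k (kdot d x / l)) *: edir R d -
      (y + (a * rprof (CS d).1 (CS d).2 k (kdot d y / l)) *: edir R d) =
      z + eta k *: edir R d.
    by rewrite opprD addrACA -scalerBl -mulrBr.
  rewrite !dE.
  have -> : eta 2%N = - eta 0%N by rewrite /eta /rprof; ring.
  have -> : eta 3%N = - eta 1%N by rewrite /eta /rprof; ring.
  apply: inv_norm_shift4 => //.
  - by rewrite ltW//=; lra.
  - rewrite /q kdotB mulrBl -chordB /eta /rprof; ring.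
  - apply: (@le_trans _ _ (h ^+ 2 * (sqn (edir R d) * kdot d z ^+ 2))).
      by rewrite (mulrC (sqn _)) mulrA ler_wpM2r ?sqn_ge0.
    by rewrite ler_wpM2l ?sqr_ge0 ?kdot_le.
have hsum : \sum_(r < 16) F r <=
    V * (16 + (\sum_(d < 4) q d * dirgain d z) / sqn z ^+ 2 + 448 * h ^+ 3).
  rewrite sum16; apply: (@le_trans _ _ (\sum_(d < 4)
     (V * (4 + q d * dirgain d z / sqn z ^+ 2 + 112 * h ^+ 3)))).
    by apply: ler_sum => d _; exact: FE.
  rewrite -mulr_sumr ler_wpM2l ?(ltW V0)// !big_split /= -mulr_suml !sumr_const card_ord.
  by lra.
have s2 : 0 < sqn z ^+ 2 by rewrite exprn_gt0.
have h2 : 0 <= h ^+ 2 by rewrite sqr_ge0.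
have h3 : h ^+ 3 <= h ^+ 2 / 4000.
  by rewrite (exprSr h 2) ler_wpM2l//; lra.
rewrite -/V.
have [zl|lz] := leP (eucl_norm z) (l / 32).
  have hz : sqn z <= (l / 32) ^+ 2.
    rewrite -(sqr_sqrtr (sqn_ge0 z)) -eucl_normE lerXn2r ?nnegrE//.
      by rewrite eucl_normE sqrtr_ge0.
    by rewrite divr_ge0// ltW.
  have g : \sum_(d < 4) q d * dirgain d z <= - (1 / 4) * h ^+ 2 * sqn z ^+ 2.
    apply: dirgain_small => d; rewrite q1 andbT -hk.
    have /andP[c0 _] := hCS d.
    have ch : 15 / 16 * (kdot d z / l) ^+ 2 <= chord (kdot d z / l).
      apply: chord_ge.
      rewrite -(ler_pXn2r (_ : 0 < 2)%N) ?nnegrE ?divr_ge0//.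
      rewrite real_normK ?num_real// exprMn exprVn ler_pdivrMr ?exprn_gt0//.
      apply: (le_trans (sqr_kdot_le _ _)); move: hz.
      rewrite exprMn; have := sqr_ge0 l; lra.
    apply: (@le_trans _ _ (a ^+ 2 * (15 / 16 * tau ^+ 2) *
        (15 / 16 * (kdot d z / l) ^+ 2))).
      have : 0 <= a ^+ 2 * tau ^+ 2 * (kdot d z / l) ^+ 2.
        by apply: mulr_ge0; [apply: mulr_ge0|]; exact: sqr_ge0.
      lra.
    rewrite /q; apply: ler_pM => //.
    - by apply: mulr_ge0; [exact: sqr_ge0|apply: mulr_ge0 => //; exact: sqr_ge0].
    - by apply: mulr_ge0 => //; exact: sqr_ge0.
    - by rewrite ler_wpM2l ?sqr_ge0.
  have g' : (\sum_(d < 4) q d * dirgain d z) / sqn z ^+ 2 <= - (1 / 4) * h ^+ 2.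
    by rewrite ler_pdivrMr.
  have : \sum_(r < 16) F r <= V * (16 - h ^+ 2 / 8).
    by apply: (le_trans hsum); rewrite ler_wpM2l ?(ltW V0)//; lra.
  have : 0 <= 64 * h ^+ 2 / l by rewrite divr_ge0 ?mulr_ge0// ltW.
  by rewrite -/F; lra.
have g : \sum_(d < 4) q d * dirgain d z <= 3 / 2 * h ^+ 2 * sqn z ^+ 2.
  by apply: dirgain_large => d; rewrite q0 q1.
have g' : (\sum_(d < 4) q d * dirgain d z) / sqn z ^+ 2 <= 3 / 2 * h ^+ 2.
  by rewrite ler_pdivrMr.
have : \sum_(r < 16) F r <= V * (16 + 2 * h ^+ 2).
  by apply: (le_trans hsum); rewrite ler_wpM2l ?(ltW V0)//; lra.
have : V * h ^+ 2 <= 32 / l * h ^+ 2.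
  rewrite ler_wpM2r// /V -[32 / l]invrK invf_div lef_pV2 ?posrE ?divr_gt0//.
    exact: ltW.
  by apply: lt_trans lz; rewrite divr_gt0.
have : 0 <= V * h ^+ 2 by rewrite mulr_ge0 ?(ltW V0).
by rewrite -/F; lra.
Qed.

End shift.

(** * Averages over independent digits *)

Section averages.
Context (R : realType).
Implicit Types (c : nat -> nat) (q r m : nat) (F G : (nat -> nat) -> R).

Definition upd c q r : nat -> nat := fun i => if i == q then r else c i.

Definition avg_digit q F c : R := (\sum_(r < 16) F (upd c q r)) / 16.

(** Most significant digit first, so that appending a digit amounts to replacing
    [k] by [k * 16 + r] and leaves the previous digits in place. *)
Definition digits_of m k : nat -> nat :=
  fun i => if (i < m)%N then ((k %/ 16 ^ (m - i.+1)) %% 16)%N else 0%N.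

Definition avg m F : R := (\sum_(k < 16 ^ m) F (digits_of m k)) / 16 ^+ m.

Lemma digits_of_upd m k r : (r < 16)%N -> digits_of m.+1 (k * 16 + r) = upd (digits_of m k) m r.
Proof.
move=> r16; apply/funext => i; rewrite /digits_of /upd ltnS leq_eqVlt.
case: eqVneq => [->|im] /=.
  by rewrite subnn expn0 divn1 modnMDl modn_small.
case: ltnP => // ilt.
by rewrite subSn// expnS divnMA divnMDl// (divn_small r16) addn0.
Qed.

Lemma avgS m F : avg m.+1 F = avg m (avg_digit m F).
Proof.
rewrite /avg /avg_digit -mulr_suml exprS invfM mulrA [in RHS]mulrAC.
rewrite [in LHS]mulrAC; congr (_ / _ / _).
rewrite expnSr -(big_mkord xpredT (fun k => F (digits_of m.+1 k))) big_nat_mul big_mkord.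
apply: eq_bigr => k _; rewrite -{1}[(k * 16)%N]add0n mulSn big_addn addnK.
rewrite big_mkord; apply: eq_bigr => r _.
by rewrite addnC digits_of_upd.
Qed.

Lemma le_avg m F G : (forall c, F c <= G c) -> avg m F <= avg m G.
Proof.
by move=> FG; rewrite ler_wpM2r ?invr_ge0 ?exprn_ge0// ler_sum.
Qed.

Lemma avg_affine m F (a b : R) : avg m (fun c => a * F c + b) = a * avg m F + b.
Proof.
rewrite /avg big_split /= -mulr_sumr sumr_const card_ord mulrDl mulrA.
by rewrite -(mulr_natr b) natrX mulfK// expf_neq0.
Qed.

Lemma avg_cst m (b : R) : avg m (fun=> b) = b.
Proof.
by rewrite /avg sumr_const card_ord -(mulr_natr b) natrX mulfK// expf_neq0.
Qed.

(** Independence of the digits: averaging over one of them first changes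
    nothing, which allows conditioning on all the others. *)
Lemma avg_avg_digit m q F : (q < m)%N -> avg m (avg_digit q F) = avg m F.
Proof.
elim: m F => // m IH F; rewrite ltnS leq_eqVlt => /predU1P[->|qm].
  rewrite !avgS; congr avg; apply/funext => c; rewrite {1 3}/avg_digit.
  congr (_ / _); rewrite /avg_digit -mulr_suml (eq_bigr (fun=> \sum_(r < 16) F (upd c m r))).
    by rewrite sumr_const card_ord -[X in X / _]mulr_natr mulfK.
  move=> r _; apply: eq_bigr => r' _; congr F.
  by apply/funext => i; rewrite /upd; case: eqP.
rewrite !avgS -(IH (avg_digit m F))//; congr avg; apply/funext => c.
rewrite /avg_digit -!mulr_suml exchange_big /=; congr (_ / _ / _).
apply: eq_bigr => r _; apply: eq_bigr => r' _; congr F; apply/funext => i.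
rewrite /upd; case: eqVneq => // ->; case: eqVneq => // mq.
by rewrite mq ltnn in qm.
Qed.

End averages.

(** * Random digits *)

Section digits.
Context (R : realType).
Local Notation P := (uniform_prob (@ltr01 R)).
Local Notation mu := (@lebesgue_measure R).

(** For [w] between 0 and 1, the digits of its expansion in base 16. *)
Definition digit (w : R) (q : nat) : nat :=
  (Num.truncn (16 ^+ q.+1 * w) %% 16)%N.

Lemma truncn_divn (x : R) (n : nat) : (0 < n)%N ->
  (Num.truncn x %/ n)%N = Num.truncn (x / n%:R).
Proof.
move=> n0; have np : 0 < n%:R :> R by rewrite ltr0n.
have [x0|x0] := ltP x 0.
  have t0 (y : R) : y < 0 -> Num.truncn y = 0%N.
    by move=> y0; apply/eqP; rewrite -leqn0 truncn_le_nat (lt_trans y0 ltr01).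
  by rewrite !t0 ?div0n// pmulr_llt0// invr_gt0.
apply/esym/truncn_def; have /andP[h1 h2] := truncn_itv x0.
rewrite ler_pdivlMr// ltr_pdivrMr// -!natrM; apply/andP; split.
  by apply: le_trans h1; rewrite ler_nat leq_divM.
by apply: (lt_le_trans h2); rewrite ler_nat ltn_ceil.
Qed.

Lemma digitE (w : R) m i : (i < m)%N ->
  digit w i = digits_of m (Num.truncn (16 ^+ m * w)) i.
Proof.
move=> im; rewrite /digits_of im /digit truncn_divn ?expn_gt0//.
have -> : 16 ^+ m = 16 ^+ (m - i.+1) * 16 ^+ i.+1 :> R by rewrite -exprD subnK.
by rewrite natrX -[X in X / _]mulrA [X in X / _]mulrC mulfK// expf_neq0.
Qed.

Definition depends_below m (Q : (nat -> nat) -> Prop) :=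
  forall c c', (forall i, (i < m)%N -> c i = c' i) -> Q c -> Q c'.

Lemma depends_below_digit m Q (w : R) : depends_below m Q ->
  Q (digit w) <-> Q (digits_of m (Num.truncn (16 ^+ m * w))).
Proof.
by move=> mQ; split; apply: mQ => i im; rewrite (digitE w im).
Qed.

Lemma measurable_truncn_eq (a : R) (k : nat) : 0 < a ->
  measurable [set w : R | Num.truncn (a * w) = k].
Proof.
move=> a0.
rewrite (_ : [set w | _] = [set w | (Num.truncn (a * w) <= k)%N] `&`
  [set w | (k <= Num.truncn (a * w))%N]); last first.
  apply/seteqP; split => [w /= <-|w /= [h1 h2]]; first by split => /=.
  by apply/eqP; rewrite eqn_leq h1.
apply: measurableI.
  rewrite (_ : [set w | _] = `]-oo, (k.+1%:R / a)[%classic)//.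
  apply/seteqP; split => w /=; rewrite in_itv/= truncn_le_nat ltr_pdivlMr//.
    by rewrite mulrC.
  by rewrite mulrC.
case: k => [|k]; first by rewrite (_ : [set w | _] = setT)//; apply/seteqP; split.
rewrite (_ : [set w | _] = `[(k.+1%:R / a), +oo[%classic)//.
apply/seteqP; split => w /=; rewrite in_itv/= truncn_gt_nat ler_pdivrMr//.
  by rewrite mulrC andbT.
by rewrite mulrC andbT.
Qed.

Lemma measurable_digit m (Q : (nat -> nat) -> Prop) : depends_below m Q ->
  measurable [set w : R | Q (digit w)].
Proof.
move=> mQ.
rewrite (_ : [set w | _] = \bigcup_(k in [set k | Q (digits_of m k)])
    [set w : R | Num.truncn (16 ^+ m * w) = k]); last first.
  apply/seteqP; split => [w /=|w [k /= Qk kE]].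
    by move/(depends_below_digit _ mQ) => h; exists (Num.truncn (16 ^+ m * w)).
  by apply/(depends_below_digit _ mQ); rewrite kE.
apply: bigcup_measurable => k _; apply: measurable_truncn_eq.
by rewrite exprn_gt0.
Qed.

Lemma uniform_prob_le (U : set R) : measurable U -> (P U <= mu U)%E.
Proof.
move=> mU; rewrite /uniform_prob.
rewrite -[leRHS]mul1e -(integral_cst mu mU 1%E).
apply: ge0_le_integral => //=.
- by move=> x _; rewrite lee_fin uniform_pdf_ge0.
- by apply/measurable_EFinP/measurable_funTS; exact: measurable_uniform_pdf.
- move=> x _; rewrite lee_fin /uniform_pdf; case: ifP => // _.
  by rewrite subr0 invr1.
Qed.

Lemma uniform_prob_out (U : set R) : measurable U -> U `<=` ~` `[0, 1] -> P U = 0%E.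
Proof.
move=> mU U01; rewrite /uniform_prob integral_uniform_pdf.
by rewrite (_ : U `&` _ = set0) ?integral_set0// -subset0 => x [/U01].
Qed.

(** The first [m] digits are uniformly distributed: the union of the intervals
    corresponding to favourable words covers the event up to a null set. *)
Lemma prob_digit_le m (Q : (nat -> nat) -> Prop) : depends_below m Q ->
  (P [set w | Q (digit w)] <= (avg m (fun c => `[< Q c >]%:R))%:E)%E.
Proof.
move=> mQ; have M0 : 0 < 16 ^+ m :> R by rewrite exprn_gt0.
pose I k : set R := if `[< Q (digits_of m k) >]
  then `[k%:R / 16 ^+ m, k.+1%:R / 16 ^+ m[%classic else set0.
have mI k : measurable (I k) by rewrite /I; case: ifP.
have PI k : (P (I k) <= (`[< Q (digits_of m k) >]%:R / 16 ^+ m)%:E)%E.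
  apply: (le_trans (uniform_prob_le (mI k))); rewrite /I; case: ifP => _.
    rewrite lebesgue_measure_itv /= lte_fin ltr_pM2r ?invr_gt0// ltr_nat ltnSn.
    by rewrite -EFinD lee_fin -mulrBl -natr1 addrAC subrr add0r.
  by rewrite measure0 mul0r.
have mA := measurable_digit mQ.
set A := [set w | _] in mA *.
pose B : set R := \big[setU/set0]_(k < 16 ^ m) I k.
have mB : measurable B by apply: bigsetU_measurable => k _; exact: mI.
pose O : set R := `]-oo, 0[%classic `|` `]1, +oo[%classic.
have mO : measurable O by apply: measurableU.
pose T : set R := [set 1].
have mT : measurable T by exact: measurable_set1.
have sub : A `<=` (B `|` O) `|` T.
  move=> w Aw.
  have [w0|w0] := ltP w 0; first by left; right; left; rewrite /= in_itv.
  have [w1|w1|->] := ltgtP w 1; [|by left; right; right; rewrite /= in_itv/= w1|by right].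
  left; left; rewrite /B.
  have x0 : 0 <= 16 ^+ m * w by rewrite mulr_ge0// ltW.
  set k := Num.truncn (16 ^+ m * w).
  have klt : (k < 16 ^ m)%N.
    by rewrite truncn_lt_nat// natrX -[ltRHS]mulr1 ltr_pM2l.
  rewrite -bigcup_mkord; exists k => //.
  have Qk : Q (digits_of m k) by apply/(depends_below_digit _ mQ).
  have /andP[h1 h2] := truncn_itv x0.
  rewrite /I (asboolT Qk) /= in_itv/= ler_pdivrMr// ltr_pdivlMr//.
  by rewrite ![w * _]mulrC h1 h2.
have PO : P O = 0%E.
  apply: uniform_prob_out => // w [] /=; rewrite !in_itv/= => h /andP[h1 h2].
    by rewrite ltNge h1 in h.
  by rewrite andbT ltNge h2 in h.
have PT : P T = 0%E.
  apply/eqP; rewrite eq_le measure_ge0 andbT.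
  by apply: (le_trans (uniform_prob_le mT)); rewrite lebesgue_measure_set1.
have mBO : measurable (B `|` O) by exact: measurableU.
apply: (@le_trans _ _ (P ((B `|` O) `|` T))).
  by apply: le_measure; rewrite ?inE//; exact: measurableU.
have e1 : P ((B `|` O) `|` T) = P (B `|` O) by exact: measureU0.
have e2 : P (B `|` O) = P B by exact: measureU0.
rewrite e1 e2.
apply: (le_trans (Boole_inequality _ _)); first by move=> k _; exact: mI.
rewrite /avg mulr_suml -sumEFin; apply: lee_sum => k _; exact: PI.
Qed.

(** By the Markov inequality [D N] is smaller than [rho] with probability at most
    [rho * K], for every [N].  So the event that this happens for all large [N]
    has probability at most [rho * K], and [rho] is arbitrary. *)
Lemma ae_frequently_ge (D : nat -> (nat -> nat) -> R) (K : R) (m0 : nat) :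
    (forall N c c', (forall i, (i < N)%N -> c i = c' i) -> D N c = D N c') ->
    (forall N c, (m0 <= N)%N -> 0 < D N c) ->
    (forall N, (m0 <= N)%N -> avg N (fun c => (D N c)^-1) <= K) ->
  {ae P, forall w, exists2 rho : R, 0 < rho &
    forall M, exists2 N, (M <= N)%N & rho <= D N (digit w)}.
Proof.
move=> Dfit D0 DK.
pose rho k : R := k.+1%:R^-1.
have rho0 k : 0 < rho k by rewrite invr_gt0.
pose B k N : set R := [set w | D N (digit w) < rho k].
have fB k N : depends_below N (fun c => D N c < rho k).
  by move=> c c' /Dfit ->.
have mB k N : measurable (B k N) by exact: measurable_digit (fB k N).
have PB k N : (m0 <= N)%N -> (P (B k N) <= (rho k * K)%:E)%E.
  move=> mN; apply: (le_trans (prob_digit_le (fB k N))); rewrite lee_fin.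
  apply: (@le_trans _ _ (rho k * avg N (fun c => (D N c)^-1))); last first.
    by rewrite ler_wpM2l ?DK// ltW.
  rewrite -[leRHS]addr0 -avg_affine; apply: le_avg => c; rewrite addr0.
  case: asboolP => [h|_]; last first.
    by rewrite divr_ge0 ?(ltW (rho0 k)) ?(ltW (D0 _ _ mN)).
  by rewrite ler_pdivlMr ?D0// mul1r ltW.
pose C k M : set R := \bigcap_(N in [set N | (M <= N)%N]) B k N.
have mC k M : measurable (C k M).
  by apply: bigcap_measurable => [|N _]; [exists M => /=|exact: mB].
pose E k : set R := \bigcup_M C k M.
have mE k : measurable (E k) by apply: bigcupT_measurable.
have PE k : (P (E k) <= (rho k * K)%:E)%E.
  have Cnd : {homo C k : a b / (a <= b)%N >-> (a <= b)%O}.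
    move=> a b ab; apply/subsetPset => w h N /= bN; apply: h => /=.
    exact: leq_trans ab bN.
  have cv := nondecreasing_cvg_mu (mu := P) (mC k) (mE k) Cnd.
  rewrite -(cvg_lim _ cv)//; apply: lime_le; first by apply/cvg_ex; exists (P (E k)).
  apply: nearW => M.
  apply: (@le_trans _ _ (P (B k (maxn M m0)))); last by rewrite PB// leq_maxr.
  apply: le_measure; rewrite ?inE; [exact: mC|exact: mB|].
  by move=> w; apply => /=; rewrite leq_maxl.
exists (\bigcap_k E k); split.
- exact: bigcapT_measurable.
- apply/eqP; rewrite eq_le measure_ge0 andbT.
  apply/lee_addgt0Pr => e e0; rewrite add0e.
  have K0 : 0 <= K.
    apply: le_trans (DK m0 _) => //; rewrite -(avg_cst m0 0); apply: le_avg => c.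
    by rewrite invr_ge0 ltW// D0.
  pose k := Num.truncn (K / e).
  apply: (@le_trans _ _ (P (E k))).
    apply: le_measure; rewrite ?inE; [exact: bigcapT_measurable|exact: mE|].
    by move=> w; exact.
  apply: (le_trans (PE k)); rewrite lee_fin /rho mulrC ler_pdivrMr//.
  rewrite -ler_pdivrMl// mulrC; apply/ltW/truncnS_gt.
- move=> w /= nw k _; rewrite /E /C.
  apply: contrapT => nE; apply: nw; exists (rho k) => // M.
  apply: contrapT => nM; apply: nE; exists M => // N /= MN.
  by rewrite /B /= ltNge; apply/negP => h; apply: nM; exists N.
Qed.

End digits.

(** * The random velocity field *)

Section rV_limits.
Context (R : realType).

Lemma cvg_rowP (T : Type) (F : set_system T) (n : nat) (f : T -> 'rV[R]_n)
    (l : 'rV[R]_n) : Filter F ->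
  (forall i, f x 0 i @[x --> F] --> l 0 i) -> f x @[x --> F] --> l.
Proof.
move=> FF fl A [P /= lP sPA]; rewrite /nbhs /=.
apply: (@filterS _ F _ [set x | forall i, P 0 i (f x 0 i)]).
  by move=> x /= Px; apply: sPA => /= i j; rewrite ord1.
apply: filter_forall => i; exact: (fl i (P 0 i) (lP 0 i)).
Qed.

Lemma continuous_kdot d : continuous (@kdot R d).
Proof.
have c0 : continuous (fun x : 'rV[R]_2 => x 0 0) by exact: coord_continuous.
have c1 : continuous (fun x : 'rV[R]_2 => x 0 1) by exact: coord_continuous.
move=> x; move: d => [|[|[|d]]]; rewrite /kdot.
- exact: c1.
- exact: c0.
- exact: (continuousD (c0 x) (c1 x)).
- exact: (continuousB (c0 x) (c1 x)).
Qed.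

Lemma continuous_prof q : continuous (@prof R q).
Proof.
move=> x; move: q => [|[|[|q]]]; rewrite /prof.
- exact: continuous_cos.
- exact: continuous_sin.
- by apply: cvgN; exact: continuous_cos.
- by apply: cvgN; exact: continuous_sin.
Qed.

Lemma continuous_rprof (C S : R) q : continuous (rprof C S q).
Proof.
move=> x; have cC : {for x, continuous (fun x => C * cos x)}.
  by apply: cvgMl_tmp; exact: continuous_cos.
have cS : {for x, continuous (fun x => S * sin x)}.
  by apply: cvgMl_tmp; exact: continuous_sin.
have cC' : {for x, continuous (fun x => C * sin x)}.
  by apply: cvgMl_tmp; exact: continuous_sin.
have cS' : {for x, continuous (fun x => S * cos x)}.
  by apply: cvgMl_tmp; exact: continuous_cos.
move: q => [|[|[|q]]]; rewrite /rprof.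
- by apply: cvgB.
- by apply: cvgD.
- by apply: cvgN; apply: cvgB.
- by apply: cvgN; apply: cvgD.
Qed.

End rV_limits.

Section field.
Context (R : realType) (alpha : R).
Hypotheses (alpha_ge0 : 0 <= alpha) (alpha_lt : alpha < 1 / 2).
Implicit Types (c : nat -> nat) (j r d : nat) (t : R) (x y : 'rV[R]_2).

Local Notation time := (@time R).
Local Notation scl := (scl alpha).
Local Notation amp := (amp alpha).

Definition shear j r x : 'rV[R]_2 :=
  (amp j * prof (phase r) (kdot (dir r) x / scl j)) *: edir R (dir r).

Definition in_step j t := (time j.+1 <= t) && (t < time j).

Definition step t := xget 0%N [set j | in_step j t].

Definition field c t x : 'rV[R]_2 :=
  if in_step (step t) t then shear (step t) (c (step t)) x else 0.

Lemma in_step_inj j j' t : in_step j t -> in_step j' t -> j = j'.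
Proof.
suff lt i i' : in_step i t -> in_step i' t -> ~~ (i < i')%N.
  by move=> h h'; apply/eqP; rewrite eqn_leq leqNgt (lt _ _ h' h) leqNgt lt.
move=> /andP[h1 _] /andP[_ h2]; apply/negP => /(@time_nincr R) h3.
by move: (lt_le_trans h2 (le_trans h3 h1)); rewrite ltxx.
Qed.

Lemma step_eq j t : in_step j t -> step t = j.
Proof.
move=> h; rewrite /step; case: xgetP => [i _ /= hi|/(_ j)//].
exact: in_step_inj hi h.
Qed.

Lemma fieldE c j t : in_step j t -> field c t = shear j (c j).
Proof. by move=> h; apply/funext => x; rewrite /field (step_eq h) h. Qed.

Lemma fieldP c t : (exists2 j, in_step j t & field c t = shear j (c j)) \/
  (forall j, ~~ in_step j t) /\ field c t = fun=> 0.
Proof.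
have [h|h] := boolP (in_step (step t) t).
  by left; exists (step t) => //; exact: fieldE.
right; split; last by apply/funext => x; rewrite /field (negbTE h).
by move=> j; apply: contra h => h; rewrite (step_eq h).
Qed.

Lemma in_step_ex t : 0 < t < 1 -> exists j, in_step j t.
Proof.
move=> /andP[t0 t1].
have ex : exists j, time j.+1 <= t.
  have [N _ h] := near_time_le t0.
  by exists N; apply: h => /=.
case: (ex_minnP ex) => j jt jmin; exists j; rewrite /in_step jt /=.
case: j jt jmin => [|j] jt jmin; first by rewrite time0.
by rewrite ltNge; apply/negP => /jmin; rewrite ltnn.
Qed.

Lemma in_step_itv j t : in_step j t -> 0 <= t <= 1.
Proof.
move=> /andP[h1 h2]; apply/andP; split.
  exact: le_trans (ltW (time_gt0 _ _)) h1.
exact: le_trans (ltW h2) (time_le1 _ _).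
Qed.

(** The steps cover the time interval up to its two end points. *)
Lemma measurable_fun_steps (d : measure_display) (T : measurableType d) (f : R -> T) :
  (forall j, measurable_fun (`[time j.+1, time j[%classic : set R) f) ->
  measurable_fun (`[0, 1]%classic : set R) f.
Proof.
move=> mf.
pose E k : set R := match k with
  | 0 => [set 0] | 1 => [set 1] | k.+2 => `[time k.+1, time k[%classic end.
have mE k : measurable (E k).
  by case: k => [|[|k]]; [exact: measurable_set1|exact: measurable_set1|exact: measurable_itv].
have -> : `[0, 1]%classic = \bigcup_k E k.
  apply/seteqP; split => [s /=|s [k _]].
    rewrite in_itv/= => /andP[s0 s1].
    have [->|sn0] := eqVneq s 0; first by exists 0%N.
    have [->|sn1] := eqVneq s 1; first by exists 1%N.
    have [|j hj] := @in_step_ex s.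
      by rewrite lt_neqAle eq_sym sn0 s0 lt_neqAle sn1 s1.
    by exists j.+2 => //=; rewrite in_itv.
  case: k => [|[|k]] /=; [by move=> ->; rewrite in_itv/= lexx ler01|
    by move=> ->; rewrite in_itv/= lexx ler01|].
  by rewrite !in_itv/= => /in_step_itv.
apply/measurable_fun_bigcup => // -[|[|k]]; last exact: mf.
- exact: measurable_fun_set1.
- exact: measurable_fun_set1.
Qed.

Lemma eucl_normZ (a : R) x : eucl_norm (a *: x) = `|a| * eucl_norm x.
Proof.
rewrite !eucl_normE (_ : sqn (a *: x) = a ^+ 2 * sqn x); last first.
  by rewrite !sqnE !mxE; ring.
by rewrite sqrtrM ?sqr_ge0// sqrtr_sqr.
Qed.

Lemma eucl_norm_edir_le1 d : eucl_norm (edir R d) <= 1.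
Proof. by rewrite eucl_normE -sqrtr1 ler_wsqrtr// sqn_edir_le1. Qed.

Lemma shear_le j r x : eucl_norm (shear j r x) <= 1 / 2.
Proof.
rewrite /shear eucl_normZ -[leRHS]mulr1 ler_pM ?eucl_norm_edir_le1//.
  by rewrite eucl_normE sqrtr_ge0.
rewrite normrM -[leRHS]mulr1 ler_pM ?prof_le1//.
by rewrite ger0_norm ?amp_le1// ltW// amp_gt0.
Qed.

Lemma shear_coord_le j r x i : `|shear j r x 0 i| <= 1.
Proof.
rewrite /shear mxE normrM -[leRHS]mul1r ler_pM ?norm_edir_le1//.
rewrite normrM -[leRHS]mulr1 ler_pM ?prof_le1//.
rewrite ger0_norm ?(ltW (amp_gt0 _ _))// (le_trans (amp_le1 alpha_ge0 alpha_lt j))//.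
by lra.
Qed.

(** Interpolation between the Lipschitz bound and the sup bound. *)
Lemma prof_holder q (a s t : R) : 0 <= a <= 1 ->
  `|prof q s - prof q t| <= 2 * `|s - t| `^ a.
Proof.
move=> /andP[a0 a1].
have b1 := prof_lip q s t.
have b2 : `|prof q s - prof q t| <= 2.
  by apply: (le_trans (ler_normB _ _)); rewrite -[2]/(1 + 1) lerD ?prof_le1.
have [h|h] := leP 1 `|s - t|.
  apply: (le_trans b2); rewrite -[leLHS]mulr1 ler_wpM2l//.
  by rewrite -(one_powR a) ge0_ler_powR ?nnegrE.
have [h0|h0] := eqVneq `|s - t| 0.
  by rewrite (le_trans b1)// h0 mulr_ge0 ?powR_ge0.
apply: (le_trans b1); rewrite (@le_trans _ _ (`|s - t| `^ a))//; last first.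
  by rewrite ler_peMl ?powR_ge0// ler1n.
by rewrite ger1_powR// lt_neqAle eq_sym h0 normr_ge0 ltW.
Qed.

(** The amplitude [scl j `^ alpha / 2] compensates exactly for the oscillation at
    scale [scl j]. *)
Lemma shear_holder j r x y :
  eucl_norm (shear j r x - shear j r y) <= eucl_dist x y `^ alpha.
Proof.
have a1 : alpha <= 1 by have := alpha_lt; lra.
have s0 := scl_gt0 alpha j.
rewrite /shear -scalerBl -mulrBr eucl_normZ normrM.
rewrite (ger0_norm (ltW (amp_gt0 _ _))).
set k := kdot (dir r); set e := eucl_norm _.
have e0 : 0 <= e by rewrite /e eucl_normE sqrtr_ge0.
have e1 : e <= 1 by exact: eucl_norm_edir_le1.
set D := `|_|.
have hD : D <= 2 * (`|k (x - y)| / scl j) `^ alpha.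
  have := @prof_holder (phase r) alpha (k x / scl j) (k y / scl j).
  rewrite alpha_ge0 a1 => /(_ isT); rewrite -mulrBl -kdotB normrM.
  by rewrite (ger0_norm (_ : 0 <= (scl j)^-1)) // invr_ge0 ltW.
have he : e <= e `^ alpha.
  have [e00|ep] := eqVneq e 0; first by rewrite e00 powR_ge0.
  by rewrite ger1_powR// lt_neqAle eq_sym ep e0 e1.
have kd : `|k (x - y)| * e <= eucl_dist x y.
  rewrite /eucl_dist (eucl_normE (x - y)) -(ler_pXn2r (_ : 0 < 2)%N) ?nnegrE ?mulr_ge0 ?sqrtr_ge0//.
  rewrite sqr_sqrtr ?sqn_ge0// exprMn real_normK ?num_real// mulrC /e eucl_normE.
  by rewrite sqr_sqrtr ?sqn_ge0// kdot_le.
apply: (@le_trans _ _ (amp j * (2 * (`|k (x - y)| / scl j) `^ alpha) * e `^ alpha)).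
  apply: ler_pM => //; last by rewrite ler_wpM2l// ltW// amp_gt0.
  by apply: mulr_ge0; [exact/ltW/amp_gt0|exact: normr_ge0].
rewrite /amp; clear hD; move: (scl j) s0 => l s0.
have li : 0 <= l^-1 by rewrite invr_ge0 ltW.
have -> : (`|k (x - y)| / l) `^ alpha = `|k (x - y)| `^ alpha / l `^ alpha.
  rewrite (powRM _ _ li)//; congr (_ * _).
  by rewrite -powR_inv1 ?(ltW s0)// -powRrM mulN1r powRN.
rewrite (_ : _ * _ = `|k (x - y)| `^ alpha * e `^ alpha); last first.
  by field; rewrite gt_eqF// powR_gt0.
rewrite -powRM// ge0_ler_powR ?nnegrE ?mulr_ge0//.
by rewrite /eucl_dist eucl_normE sqrtr_ge0.
Qed.

Lemma shear_continuous j r : continuous (shear j r).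
Proof.
move=> x.
have cp : {for x, continuous (fun x => prof (phase r) (kdot (dir r) x / scl j))}.
  apply: (@continuous_comp _ _ _ (fun x => kdot (dir r) x / scl j) (prof (phase r))).
    exact: (@cvgMr_tmp _ _ _ _ _ _ _ (@continuous_kdot R (dir r) x)).
  exact: continuous_prof.
have cm : {for x, continuous (fun x => amp j * prof (phase r) (kdot (dir r) x / scl j))}.
  exact: (@cvgMl_tmp _ _ _ _ _ _ _ cp).
exact: (@cvgZr_tmp _ _ _ _ _ _ _ _ cm).
Qed.

Lemma field_continuous c t : continuous (field c t).
Proof.
have [[j _ ->]|[_ ->]] := fieldP c t; first exact: shear_continuous.
exact: cst_continuous.
Qed.

Lemma field_le c t x : eucl_norm (field c t x) <= 1 / 2.
Proof.
have [[j _ ->]|[_ ->]] := fieldP c t; first exact: shear_le.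
by rewrite eucl_normE sqnE !mxE expr0n addr0 sqrtr0 divr_ge0.
Qed.

Lemma field_coord_le c t x i : `|field c t x 0 i| <= 1.
Proof.
have [[j _ ->]|[_ ->]] := fieldP c t; first exact: shear_coord_le.
by rewrite mxE normr0.
Qed.

Lemma field_holder c t x y :
  eucl_norm (field c t x - field c t y) <= eucl_dist x y `^ alpha.
Proof.
have [[j _ ->]|[_ ->]] := fieldP c t; first exact: shear_holder.
by rewrite subrr eucl_normE sqnE !mxE expr0n addr0 sqrtr0 powR_ge0.
Qed.

Lemma eucl_norm_gt0 x : x != 0 -> 0 < eucl_norm x.
Proof.
move=> x0; rewrite eucl_normE sqrtr_gt0.
by rewrite lt_neqAle eq_sym sqn_eq0 x0 sqn_ge0.
Qed.

Lemma sup_norm_field c t : (sup_norm setT (field c t) <= (1 / 2)%:E)%E.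
Proof. by apply: ge_ereal_sup => _ [x _ <-]; rewrite lee_fin field_le. Qed.

Lemma holder_norm_field c t (a : R) : a = 0 \/ a = alpha ->
  (holder_norm (@eucl_dist R 2) setT a (field c t) <= 2%:E)%E.
Proof.
move=> ha; rewrite /holder_norm; case: ifPn => a0.
  by apply: (le_trans (sup_norm_field c t)); rewrite lee_fin; lra.
case: ha => [ha|->]; first by rewrite ha eqxx in a0.
have h : (holder_seminorm (@eucl_dist R 2) setT alpha (field c t) <= 1%:E)%E.
  apply: ge_ereal_sup => _ [[x y] /= [_ _ xy] <-]; rewrite lee_fin.
  have d0 : 0 < eucl_dist x y.
    by apply: eucl_norm_gt0; rewrite subr_eq0; apply/eqP.
  by rewrite ler_pdivrMr ?powR_gt0// mul1r field_holder.
apply: (le_trans (leeD (sup_norm_field c t) h)).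
by rewrite -EFinD lee_fin; lra.
Qed.

Lemma field_in_holder c t (a : R) : a = 0 \/ a = alpha ->
  in_holder (@eucl_dist R 2) setT a (field c t).
Proof.
move=> ha; split; last by apply: (le_lt_trans (holder_norm_field c t ha)); rewrite ltry.
by apply: continuous_subspaceT => x; exact: field_continuous.
Qed.

End field.

(** * Solutions from orbits of the step maps *)

Lemma continuous_addl (R : realType) (V : normedModType R) (a : V) :
  continuous (fun x => a + x).
Proof.
move=> x; have ci : {for x, continuous (@id V)} by exact: cvg_id.
exact: (continuousD (@cst_continuous _ _ a x) ci).
Qed.

Lemma within_continuous_comp (T U V : topologicalType) (A : set T)
    (g : U -> V) (f : T -> U) :
  continuous g -> {within A, continuous f} -> {within A, continuous (g \o f)}.
Proof. by move=> gc fc x; exact: continuous_comp (fc x) (gc _). Qed.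

Section orbits.
Context (R : realType) (alpha : R).
Hypotheses (alpha_ge0 : 0 <= alpha) (alpha_lt : alpha < 1 / 2).
Context (W : R -> 'rV[R]_2).
Hypothesis W_cont : {within `[0, 1], continuous W}.
Implicit Types (c : nat -> nat) (j r d q : nat) (t : R) (x y z : 'rV[R]_2).

Local Notation time := (@time R).
Local Notation scl := (scl alpha).
Local Notation amp := (amp alpha).
Local Notation mu := (@lebesgue_measure R).

Definition angle j d t : R := kdot d (W t) / scl j.

Definition icos j d (a b : R) : R := \int[mu]_(s in `[a, b]) cos (angle j d s).
Definition isin j d (a b : R) : R := \int[mu]_(s in `[a, b]) sin (angle j d s).

Definition trig_int j d : R * R :=
  (icos j d (time j.+1) (time j), isin j d (time j.+1) (time j)).

Lemma sub_itv01 (a b : R) : 0 <= a -> b <= 1 -> `[a, b] `<=` `[0, 1].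
Proof.
move=> a0 b1 s /=; rewrite !in_itv/= => /andP[h1 h2].
by rewrite (le_trans a0 h1) (le_trans h2 b1).
Qed.

Lemma integrable_comp_angle (f : R -> R) j d (a b : R) :
  continuous f -> 0 <= a -> b <= 1 ->
  mu.-integrable `[a, b] (EFin \o (fun s => f (angle j d s))).
Proof.
move=> fc a0 b1; apply: continuous_compact_integrable; first exact: segment_compact.
have gc : continuous (fun x => f (kdot d x / scl j)).
  move=> x; have h : {for x, continuous (fun x => kdot d x / scl j)}.
    exact: (@cvgMr_tmp _ _ _ _ _ _ _ (@continuous_kdot R d x)).
  exact: (@continuous_comp _ _ _ (fun x => kdot d x / scl j) f x h (@fc _)).
have h := within_continuous_comp gc W_cont.
exact: (continuous_subspaceW (sub_itv01 a0 b1) h).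
Qed.

Lemma mu_itv (a b : R) : a <= b -> fine (mu `[a, b]) = b - a.
Proof.
rewrite le_eqVlt => /predU1P[->|ab].
  by rewrite set_itv1 lebesgue_measure_set1 subrr.
by rewrite lebesgue_measure_itv /= lte_fin ab.
Qed.

Lemma continuous_cos_sin (A B : R) : continuous (fun x : R => cos x * A + sin x * B).
Proof.
move=> x.
have h1 : {for x, continuous (fun x : R => cos x * A)}.
  exact: (@cvgMr_tmp _ _ _ _ _ _ _ (@continuous_cos R x)).
have h2 : {for x, continuous (fun x : R => sin x * B)}.
  exact: (@cvgMr_tmp _ _ _ _ _ _ _ (@continuous_sin R x)).
exact: (continuousD h1 h2).
Qed.

Lemma integrable_cst_itv (a b k : R) : 0 <= a -> b <= 1 ->
  mu.-integrable `[a, b] (EFin \o (fun=> k)).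
Proof.
move=> a0 b1; exact: (@integrable_comp_angle (fun=> k) 0 0 a b (@cst_continuous _ _ k)).
Qed.

Lemma icos_isin_lin j d (a b A B : R) : 0 <= a -> b <= 1 ->
  \int[mu]_(s in `[a, b]) (cos (angle j d s) * A + sin (angle j d s) * B) =
  icos j d a b * A + isin j d a b * B.
Proof.
move=> a0 b1.
have ic := integrable_comp_angle j d (@continuous_cos R) a0 b1.
have is' := integrable_comp_angle j d (@continuous_sin R) a0 b1.
have cA : continuous (fun x : R => cos x * A).
  by move=> x; exact: (@cvgMr_tmp _ _ _ _ _ _ _ (@continuous_cos R x)).
have cB : continuous (fun x : R => sin x * B).
  by move=> x; exact: (@cvgMr_tmp _ _ _ _ _ _ _ (@continuous_sin R x)).
have icA := integrable_comp_angle j d cA a0 b1.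
have isB := integrable_comp_angle j d cB a0 b1.
by rewrite RintegralD// !RintegralZr.
Qed.

Lemma int_prof q j d (theta a b : R) : 0 <= a -> b <= 1 ->
  \int[mu]_(s in `[a, b]) prof q (theta + angle j d s) =
  rprof (icos j d a b) (isin j d a b) q theta.
Proof.
move=> a0 b1.
have [A [B AB]] : exists A B, forall C S, rprof C S q theta = C * A + S * B.
  move: q => [|[|[|q]]]; rewrite /rprof.
  - by exists (cos theta), (- sin theta) => C S; ring.
  - by exists (sin theta), (cos theta) => C S; ring.
  - by exists (- cos theta), (sin theta) => C S; ring.
  - by exists (- sin theta), (- cos theta) => C S; ring.
rewrite AB -icos_isin_lin//; apply: eq_Rintegral => s _.
by rewrite profD AB.
Qed.

(** With [rho] the modulus of the integral of [e^{i angle}], integrating the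
    Cauchy-Schwarz inequality against the direction of this integral gives
    [rho ^+ 2 <= rho * dur j]. *)
Lemma trig_int_sqr_le j d : (trig_int j d).1 ^+ 2 + (trig_int j d).2 ^+ 2 <= dur R j ^+ 2.
Proof.
rewrite /=; set C := icos _ _ _ _; set S := isin _ _ _ _.
have t0 : 0 <= time j.+1 by rewrite ltW ?time_gt0.
have t1 := time_le1 R j.
have d0 := dur_gt0 R j.
pose rho := Num.sqrt (C ^+ 2 + S ^+ 2).
have CS0 : 0 <= C ^+ 2 + S ^+ 2 by rewrite addr_ge0 ?sqr_ge0.
have rho2 : rho ^+ 2 = C ^+ 2 + S ^+ 2 by rewrite sqr_sqrtr.
have rho0 : 0 <= rho by rewrite sqrtr_ge0.
have h : rho ^+ 2 <= rho * dur R j.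
  rewrite rho2 [leLHS](_ : _ = C * C + S * S); last by rewrite !expr2.
  rewrite /dur -(icos_isin_lin j d C S t0 t1) -(mu_itv (ltW (timeS_lt R j))).
  rewrite -Rintegral_cst//; apply: le_Rintegral => //.
  - exact: (integrable_comp_angle j d (@continuous_cos_sin C S) t0 t1).
  - exact: integrable_cst_itv.
  move=> s _; set w := angle j d s.
  apply: (le_trans (ler_norm _)).
  rewrite -(ler_pXn2r (_ : 0 < 2)%N) ?nnegrE// real_normK ?num_real// rho2.
  rewrite -[leRHS]mulr1 -(cos2Dsin2 w) -subr_ge0.
  rewrite (_ : _ - _ = (C * sin w - S * cos w) ^+ 2) ?sqr_ge0//; ring.
rewrite -rho2 lerXn2r ?nnegrE ?(ltW d0)//.
have [r0|r0] := eqVneq rho 0; first by rewrite r0 ltW.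
by move: h; rewrite expr2 ler_pM2l// lt_neqAle eq_sym r0.
Qed.

(** If the path moves little compared with the scale during the step, then the
    integrand hardly turns and there is almost no cancellation. *)
Lemma trig_int_sqr_ge j d :
    (forall s, time j.+1 <= s <= time j ->
      `|angle j d s - angle j d (time j.+1)| <= 1 / 32) ->
  15 / 16 * dur R j ^+ 2 <= (trig_int j d).1 ^+ 2 + (trig_int j d).2 ^+ 2.
Proof.
move=> hosc; rewrite /=; set C := icos _ _ _ _; set S := isin _ _ _ _.
have t0 : 0 <= time j.+1 by rewrite ltW ?time_gt0.
have t1 := time_le1 R j.
have d0 := dur_gt0 R j.
set w0 := angle j d (time j.+1).
have h : 99 / 100 * dur R j <= C * cos w0 + S * sin w0.
  rewrite /dur -(icos_isin_lin j d (cos w0) (sin w0) t0 t1).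
  rewrite -(mu_itv (ltW (timeS_lt R j))).
  rewrite -Rintegral_cst//; apply: le_Rintegral => //.
  - exact: integrable_cst_itv.
  - exact: (integrable_comp_angle j d (@continuous_cos_sin (cos w0) (sin w0)) t0 t1).
  move=> s; rewrite /= in_itv/= => /hosc hs; rewrite -cosB.
  apply: (le_trans _ (cos_ge_sqr _)).
  have : (angle j d s - w0) ^+ 2 <= (1 / 32) ^+ 2.
    by rewrite -(real_normK (num_real (_ - _))) lerXn2r ?nnegrE// divr_ge0.
  by lra.
have h0 : 0 <= 99 / 100 * dur R j by rewrite mulr_ge0// ltW.
have h2 : (99 / 100 * dur R j) ^+ 2 <= (C * cos w0 + S * sin w0) ^+ 2.
  by rewrite lerXn2r ?nnegrE// (le_trans h0).
have h3 : (C * cos w0 + S * sin w0) ^+ 2 <= C ^+ 2 + S ^+ 2.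
  rewrite -[leRHS]mulr1 -(cos2Dsin2 w0) -subr_ge0.
  by rewrite (_ : _ - _ = (C * sin w0 - S * cos w0) ^+ 2) ?sqr_ge0//; ring.
apply: (le_trans _ (le_trans h2 h3)); rewrite exprMn.
by have := sqr_ge0 (dur R j); lra.
Qed.

(** In the frame moving with [W], step [j] acts on positions by an explicit
    homeomorphism. *)
Definition step_map c j z := shift (amp j) (scl j) (trig_int j) (c j) z.
Definition step_inv c j z := unshift (amp j) (scl j) (trig_int j) (c j) z.

Lemma disp_coord_le c j z i :
  `|disp (amp j) (scl j) (trig_int j) (c j) z 0 i| <= dur R j.
Proof.
apply: disp_le; [|exact/ltW/dur_gt0|exact: trig_int_sqr_le].
rewrite (ltW (amp_gt0 _ _))/= (le_trans (amp_le1 alpha_ge0 alpha_lt j))//.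
by lra.
Qed.

Section solution.
Context (c : nat -> nat) (y : 'rV[R]_2) (z : nat -> 'rV[R]_2).
Hypothesis z_orbit : forall j, z j = step_map c j (z j.+1).
Hypothesis z_start : forall j i, `|z j 0 i - (y - W 0) 0 i| <= time j.

(** Inside a step the velocity along the solution is not affected by the
    displacement caused by the shear itself, so it can be written in terms of
    the position at the beginning of the step. *)
Definition vel t : 'rV[R]_2 := field alpha c t (z (step t).+1 + W t).

Definition orbit_int t : 'rV[R]_2 :=
  \row_i \int[mu]_(s in `[0, t]) vel s 0 i.

Lemma vel_step j s : in_step j s -> vel s = shear alpha j (c j) (z j.+1 + W s).
Proof. by move=> h; rewrite /vel (step_eq h) (fieldE _ _ h). Qed.

Lemma shear_orbit j i s : shear alpha j (c j) (z j.+1 + W s) 0 i =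
  amp j * edir R (dir (c j)) 0 i *
  prof (phase (c j)) (kdot (dir (c j)) (z j.+1) / scl j + angle j (dir (c j)) s).
Proof. by rewrite /shear mxE kdotD mulrDl /angle; ring. Qed.

Lemma measurable_vel i :
  measurable_fun (`[0, 1]%classic : set R) (fun s : R => vel s 0 i).
Proof.
apply: measurable_fun_steps => k.
apply: (eq_measurable_fun (fun s => shear alpha k (c k) (z k.+1 + W s) 0 i)).
  by move=> s; rewrite inE /= in_itv/= => h; rewrite (vel_step h).
suff mg : measurable_fun (`[0, 1]%classic : set R)
    (fun s : R => shear alpha k (c k) (z k.+1 + W s) 0 i).
  apply: (measurable_funS _ _ mg) => //.
  by move=> s /=; rewrite !in_itv/= => /in_step_itv.
apply: subspace_continuous_measurable_fun => //.
have gc : continuous (fun x => shear alpha k (c k) (z k.+1 + x) 0 i).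
  move=> x.
  have h1 : {for x, continuous (fun x => z k.+1 + x)} by exact: continuous_addl.
  have h2 := @continuous_comp _ _ _ _ _ x h1 (@shear_continuous _ alpha k (c k) _).
  exact: (@continuous_comp _ _ _ _ _ x h2 (@coord_continuous R 1 2 0 i _)).
exact: (within_continuous_comp gc W_cont).
Qed.

Lemma vel_coord_le s i : `|vel s 0 i| <= 1.
Proof. exact: field_coord_le. Qed.

Lemma integrable_vel i : mu.-integrable `[0, 1] (EFin \o (fun s => vel s 0 i)).
Proof.
pose I01 : set R := `[0, 1]%classic.
have m1 : (mu I01 < +oo)%E.
  by rewrite lebesgue_measure_itv /= lte_fin ltr01 -EFinB ltry.
apply: measurable_bounded_integrable => //.
- exact: measurable_vel.
- by exists 1; split => // M M1 s _; exact: le_trans (vel_coord_le s i) (ltW M1).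
Qed.

Lemma orbit_int_le t i : 0 <= t <= 1 -> `|orbit_int t 0 i| <= t.
Proof.
move=> /andP[t0 t1]; rewrite mxE.
have iv : mu.-integrable `[0, t] (EFin \o (fun s => vel s 0 i)).
  by apply: integrableS (integrable_vel i) => //; exact: sub_itv01.
apply: (le_trans (le_normr_Rintegral _ iv)) => //.
rewrite -[leRHS]subr0 -(mu_itv t0) -[leRHS]mul1r -Rintegral_cst//.
apply: le_Rintegral => //.
- exact: (integrable_norm iv).
- exact: integrable_cst_itv.
- by move=> s _; exact: vel_coord_le.
Qed.

Lemma orbit_int_step j t : time j.+1 <= t <= time j ->
  orbit_int t - orbit_int (time j.+1) =
  (amp j * rprof (icos j (dir (c j)) (time j.+1) t) (isin j (dir (c j)) (time j.+1) t)
    (phase (c j)) (kdot (dir (c j)) (z j.+1) / scl j)) *: edir R (dir (c j)).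
Proof.
move=> /andP[jt tj].
have s0 : 0 <= time j.+1 by rewrite ltW ?time_gt0.
have t1 : t <= 1 by exact: le_trans tj (time_le1 _ _).
have t0 : 0 <= t by exact: le_trans s0 jt.
apply/rowP => i; rewrite !mxE.
have iv (a b : R) (l r : bool) : 0 <= a -> b <= 1 ->
    mu.-integrable [set` Interval (BSide l a) (BSide r b)] (EFin \o (fun s => vel s 0 i)).
  move=> a0 b1; apply: integrableS (integrable_vel i) => //.
  apply: subset_trans (sub_itv01 a0 b1).
  by apply: subset_itvScc; rewrite bnd_simp.
rewrite Rintegral_itvB ?bnd_simp//; last exact: iv.
rewrite Rintegral_itv_obnd_cbnd; last exact: iv.
rewrite -Rintegral_itv_bndo_bndc; last exact: iv.
pose g s := shear alpha j (c j) (z j.+1 + W s) 0 i.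
have -> : \int[mu]_(s in `[time j.+1, t[) vel s 0 i = \int[mu]_(s in `[time j.+1, t[) g s.
  apply: eq_Rintegral => s; rewrite inE/= in_itv/= => /andP[h1 h2].
  by rewrite (@vel_step j) // /in_step h1 (lt_le_trans h2 tj).
pose k := amp j * edir R (dir (c j)) 0 i.
have cp : continuous (fun x : R =>
    prof (phase (c j)) (kdot (dir (c j)) (z j.+1) / scl j + x)).
  move=> x.
  have h : {for x, continuous (fun s : R => kdot (dir (c j)) (z j.+1) / scl j + s)}.
    exact: (@continuous_addl R R^o).
  exact: (@continuous_comp _ _ _ _ _ x h (@continuous_prof R (phase (c j)) _)).
have ip := integrable_comp_angle j (dir (c j)) cp s0 t1.
have gE : g = fun s => k * prof (phase (c j))
    (kdot (dir (c j)) (z j.+1) / scl j + angle j (dir (c j)) s).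
  by apply/funext => s; rewrite /g shear_orbit.
have ig : mu.-integrable `[time j.+1, t] (EFin \o g).
  rewrite gE (_ : _ \o _ = fun s => (k%:E * (prof (phase (c j))
    (kdot (dir (c j)) (z j.+1) / scl j + angle j (dir (c j)) s))%:E)%E).
    exact: integrableZl.
  by apply/funext => s /=; rewrite EFinM.
rewrite Rintegral_itv_bndo_bndc; last first.
  by apply: integrableS ig => //; apply: subset_itvl; rewrite bnd_simp.
by rewrite gE RintegralZl// int_prof// /k; ring.
Qed.

(** Both sides change by the same amount in each step, so that their difference
    does not depend on [j]; and both tend to zero with [time j]. *)
Lemma orbit_int_time j : orbit_int (time j) = z j - (y - W 0).
Proof.
pose e j := orbit_int (time j) - (z j - (y - W 0)).
suff e0 : e j = 0 by apply/eqP; rewrite -subr_eq0 -/(e j) e0.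
have eS k : e k = e k.+1.
  rewrite /e [in LHS]z_orbit /step_map /shift /disp.
  have := @orbit_int_step k (time k).
  rewrite lexx (ltW (timeS_lt R k)) => /(_ isT) /eqP.
  rewrite subr_eq => /eqP -> /=.
  set D := (_ * _) *: _; rewrite [D + _]addrC -[in X in _ - X]addrA [D - _]addrC [in X in _ - X]addrA.
  by rewrite opprD addrACA subrr addr0.
have ek n : e j = e (j + n)%N.
  by elim: n => [|n IH]; rewrite ?addn0// addnS -eS.
apply/rowP => i; rewrite [RHS]mxE; apply/eqP; rewrite -normr_eq0.
rewrite eq_le normr_ge0 andbT; apply/ler_addgt0Pr => eps eps0; rewrite add0r.
have h2 : 0 < eps / 2 by rewrite divr_gt0.
have [N _ hN] := near_time_le h2.
have : time (j + N) <= eps / 2 by apply: hN => /=; rewrite leq_addl.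
rewrite (ek N) => ht.
have tb : 0 <= time (j + N) <= 1 by rewrite ltW ?time_gt0// time_le1.
have := orbit_int_le i tb; have := z_start (j + N) i.
rewrite /e; move: (orbit_int _) (z _) (y - W 0) => a b p h3 h4.
rewrite !mxE; apply: (le_trans (ler_normB _ _)).
by lra.
Qed.

Definition orbit_sol t := y + orbit_int t + W t - W 0.

Lemma orbit_sol_time j : orbit_sol (time j) = z j + W (time j).
Proof. by rewrite /orbit_sol orbit_int_time; apply/rowP => i; rewrite !mxE; ring. Qed.

Lemma field_orbit_sol t : field alpha c t (orbit_sol t) = vel t.
Proof.
have [[j hj E]|[_ E]] := fieldP alpha c t; last by rewrite /vel E.
rewrite (vel_step hj) E /shear; congr ((_ * prof _ (_ / _)) *: _).
have /andP[h1 h2] := hj.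
have := @orbit_int_step j t; rewrite h1 (ltW h2) => /(_ isT) /eqP.
rewrite subr_eq orbit_int_time => /eqP e.
rewrite /orbit_sol e; set b := _ *: _.
rewrite (_ : y + _ + _ - _ = (z j.+1 + W t) + b); last first.
  by apply/rowP => i; rewrite !mxE; ring.
by rewrite kdotD /b kdotZ kdot_edir mulr0 addr0.
Qed.

Lemma orbit_sol_caratheodory (tmax : R) : 0 < tmax <= 1 ->
  is_caratheodory tmax (field alpha c) W y orbit_sol.
Proof.
move=> /andP[T0 T1]; split; last first.
  move=> t _; rewrite [X in y + X](_ : _ = orbit_int t)//.
  apply/rowP => i; rewrite !mxE; apply: eq_Rintegral => s _.
  by rewrite field_orbit_sol.
suff h : {within `[0, 1], continuous orbit_sol}.
  exact: (continuous_subspaceW (sub_itv01 (lexx 0) T1) h).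
move=> t.
have c1 : {for t, continuous (orbit_int : subspace `[0, 1] -> 'rV[R]_2)}.
  apply: cvg_rowP => i.
  have h := @parameterized_integral_continuous R _ _ _ ler01 (integrable_vel i).
  have e : (parameterized_integral mu 0)^~ (fun s => vel s 0 i) =
      fun x : R => orbit_int x 0 i.
    by apply/funext => x; rewrite mxE.
  by rewrite e in h; exact: h.
have c2 : {for t, continuous (W : subspace `[0, 1] -> 'rV[R]_2)} by exact: W_cont.
have c3 := continuousD (@cst_continuous _ _ y t) c1.
exact: (continuousB (continuousD c3 c2) (@cst_continuous _ _ (W 0) t)).
Qed.

End solution.

End orbits.

(** * Measurability of the random field *)

Section random_field.
Context (R : realType) (alpha : R).
Hypotheses (alpha_ge0 : 0 <= alpha) (alpha_lt : alpha < 1 / 2).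
Implicit Types (c : nat -> nat) (j r d : nat) (t : R).

Local Notation time := (@time R).
Local Notation mu := (@lebesgue_measure R).

Lemma continuous_measurable_borel_rV (n : nat) (g : 'rV[R]_n -> R) :
  continuous g -> measurable_fun setT (g : borel_rV R n -> R).
Proof.
move=> /continuousP cg; apply: (measurability _ (RGenOpens.measurableE R)).
move=> _ [_ [a [b ->]] <-]; rewrite setTI.
by apply: sub_sigma_algebra; apply: cg; exact: interval_open.
Qed.

(** The drift is a countable combination of products of events, time intervals
    and continuous functions of the position. *)
Lemma measurable_random_field (i : 'I_2) :
  measurable_fun
    [set p : measurableTypeR R * measurableTypeR R * borel_rV R 2 |
      p.1.2 \in `[0, 1]]
    (fun p : measurableTypeR R * measurableTypeR R * borel_rV R 2 =>
      field alpha (digit p.1.1) p.1.2 p.2 0 i).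
Proof.
pose T3 := (measurableTypeR R * measurableTypeR R * borel_rV R 2)%type.
have mt (B : set R) : measurable B -> measurable [set p : T3 | B p.1.2].
  move=> mB; rewrite -[X in measurable X]setTI.
  by apply: (measurableT_comp measurable_snd measurable_fst).
have mw (B : set R) : measurable B -> measurable [set p : T3 | B p.1.1].
  move=> mB; rewrite -[X in measurable X]setTI.
  by apply: (measurableT_comp measurable_fst measurable_fst).
pose F j r : set T3 := [set p | in_step j p.1.2] `&` [set p | digit p.1.1 j = r].
have mF j r : measurable (F j r).
  apply: measurableI.
    apply: (mt [set t | in_step j t]).
    rewrite (_ : [set t | _] = `[time j.+1, time j[%classic)//.
  apply: (mw [set w | digit w j = r]).
  by apply: (@measurable_digit R j.+1 (fun c => c j = r)) => c c' /(_ j (ltnSn j)) <-.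
pose E k : set T3 := match k with
  | 0 => [set p | [set 0] p.1.2] | 1 => [set p | [set 1] p.1.2]
  | k.+2 => \bigcup_r F k r end.
have mE k : measurable (E k).
  case: k => [|[|k]]; [exact: (mt [set 0])|exact: (mt [set 1])|].
  by apply: bigcupT_measurable => r; exact: mF.
have -> : [set p : T3 | p.1.2 \in `[0, 1]] = \bigcup_k E k.
  apply/seteqP; split => [[[w s] x] /=|[[w s] x] [k _]].
    rewrite in_itv/= => /andP[s0 s1].
    have [s00|sn0] := eqVneq s 0; first by exists 0%N.
    have [s11|sn1] := eqVneq s 1; first by exists 1%N.
    have [|j hj] := @in_step_ex _ s.
      by rewrite lt_neqAle eq_sym sn0 s0 lt_neqAle sn1 s1.
    by exists j.+2 => //=; exists (digit w j).
  case: k => [|[|k]] /=; [by move=> ->; rewrite in_itv/= lexx ler01|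
    by move=> ->; rewrite in_itv/= lexx ler01|].
  by move=> [r _ [/= h _]]; rewrite in_itv/= (in_step_itv h).
have f0 (p : T3) : (forall j, ~~ in_step j p.1.2) ->
    field alpha (digit p.1.1) p.1.2 p.2 0 i = 0.
  move=> h; have [[j hj _]|[_ ->]] := fieldP alpha (digit p.1.1) p.1.2.
    by move: (h j); rewrite hj.
  by rewrite mxE.
have mz (A : set T3) : (forall p, A p -> forall j, ~~ in_step j p.1.2) ->
    measurable_fun A (fun p : T3 => field alpha (digit p.1.1) p.1.2 p.2 0 i).
  move=> h; have mc : measurable_fun A (fun _ : T3 => 0 : R) by exact: measurable_cst.
  by apply: eq_measurable_fun mc => p; rewrite inE => /h/f0 ->.
apply/measurable_fun_bigcup => // -[|[|k]].
- apply: mz => p /= -> j; apply/negP => /andP[+ _].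
  by rewrite leNgt time_gt0.
- apply: mz => p /= -> j; apply/negP => /andP[_].
  by rewrite ltNge time_le1.
- apply/measurable_fun_bigcup => // r.
  suff ms : measurable_fun (F k r) (fun p : T3 => shear alpha k r p.2 0 i).
    apply: eq_measurable_fun ms => p.
    by rewrite inE => -[/= h1 h2]; rewrite (fieldE _ _ h1) h2.
  apply: measurable_funTS.
  have cs : continuous (fun x : 'rV[R]_2 => shear alpha k r x 0 i).
    move=> x; exact: (@continuous_comp _ _ _ _ _ x (@shear_continuous _ alpha k r _)
      (@coord_continuous R 1 2 0 i _)).
  exact: (measurableT_comp (continuous_measurable_borel_rV cs) measurable_snd).
Qed.

Lemma sup_norm0 (d : nat) : sup_norm setT (fun _ : 'rV[R]_d => 0 : 'rV[R]_d) = 0%E.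
Proof.
rewrite /sup_norm (_ : [set _ | _ in _] = [set 0%E]) ?ereal_sup1//.
have e0 : eucl_norm (0 : 'rV[R]_d) = 0.
  rewrite /eucl_norm big1 ?sqrtr0// => i _; rewrite mxE expr0n//.
apply/seteqP; split => [_ [x _ <-]|_ ->] /=; first by rewrite e0.
by exists 0 => //; rewrite e0.
Qed.

(** Truncating the drift near time [0] leaves finitely many shear flows; at each
    time the truncation is eventually exact, which gives strong measurability. *)
Definition trunc_field c (n : nat) t : 'rV[R]_2 -> 'rV[R]_2 :=
  if (step t < n)%N then field alpha c t else fun=> 0.

Lemma trunc_field_step c n j t : in_step j t ->
  trunc_field c n t = if (j < n)%N then shear alpha j (c j) else fun=> 0.
Proof. by move=> h; rewrite /trunc_field (step_eq h) (fieldE _ _ h). Qed.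

Lemma trunc_field_out c n t : (forall j, ~~ in_step j t) ->
  trunc_field c n t = fun=> 0.
Proof.
move=> h; rewrite /trunc_field; case: ifP => // _.
have [[j hj _]|[_ ->]//] := fieldP alpha c t.
by move: (h j); rewrite hj.
Qed.

Lemma trunc_field_simple c n : C0_simple `[0, 1]%classic (trunc_field c n).
Proof.
have vals t : exists2 k, (k <= n)%N & trunc_field c n t =
    if (k < n)%N then shear alpha k (c k) else fun=> 0.
  have [[j hj _]|[h _]] := fieldP alpha c t.
    rewrite (trunc_field_step c n hj).
    case: (ltnP j n) => jn; first by exists j => //; [exact: ltnW|rewrite jn].
    by exists n => //; rewrite ltnn.
  by exists n => //; rewrite ltnn (trunc_field_out _ _ h).
split.
- apply: (@sub_finite_set _ _ ((fun k => if (k < n)%N then shear alpha k (c k)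
    else fun=> 0) @` `I_n.+1)); last by apply: finite_image; exact: finite_II.
  by move=> _ [t _ <-]; have [k kn ->] := vals t; exists k.
- move=> f.
  pose B : set R := \bigcup_(j in [set j | (j < n)%N]) `[time j.+1, time j[%classic.
  have mB : measurable B by apply: bigcup_measurable => j _; exact: measurable_itv.
  have inB j t : in_step j t -> (j < n)%N -> B t.
    by move=> h jn; exists j => //=; rewrite in_itv.
  pose A : set R := \bigcup_(j in [set j | (j < n)%N /\ shear alpha j (c j) = f])
    `[time j.+1, time j[%classic.
  have mA : measurable A by apply: bigcup_measurable => j _; exact: measurable_itv.
  pose O : set R := if `[< f = fun=> 0 >] then `[0, 1]%classic `\` B else set0.
  have mO : measurable O by rewrite /O; case: ifP => // _; exact: measurableD.
  rewrite (_ : [set t | _] = A `|` O); first exact: measurableU.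
  apply/seteqP; split => t.
    move=> /= [t01 tf].
    have [Bt|nBt] := pselect (B t).
      left; case: Bt => j /= jn; rewrite in_itv/= => hj.
      exists j; last by rewrite /= in_itv.
      by split=> //; move: tf; rewrite (trunc_field_step c n hj) jn.
    right; have f0 : f = fun=> 0.
      rewrite -tf; have [[j hj _]|[h _]] := fieldP alpha c t.
        rewrite (trunc_field_step c n hj); case: ifP => // jn.
        by case: nBt; exact: inB hj jn.
      by rewrite (trunc_field_out _ _ h).
    by rewrite /O asboolT.
  move=> [[j [jn jf] /=]|].
    rewrite in_itv/= => hj; split; first by rewrite in_itv/= (in_step_itv hj).
    by rewrite (trunc_field_step c n hj) jn.
  rewrite /O; case: asboolP => // -> [t01 nB]; split => //.
  have [[j hj _]|[h _]] := fieldP alpha c t.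
    rewrite (trunc_field_step c n hj); case: ifP => // jn.
    by case: nB; exact: inB hj jn.
  by rewrite (trunc_field_out _ _ h).
- move=> t _; rewrite /trunc_field; case: ifP => _.
    exact: (field_in_holder alpha_ge0 alpha_lt c t (or_introl erefl)).
  split; first by apply: continuous_subspaceT => x; exact: cst_continuous.
  by rewrite /holder_norm eqxx sup_norm0 ltry.
Qed.

Lemma field_in_L1C0 c : in_L1C0 1 (field alpha c).
Proof.
split.
- apply: aeW => t _.
  exact: (field_in_holder alpha_ge0 alpha_lt c t (or_introl erefl)).
- exists (trunc_field c); split; first exact: trunc_field_simple.
  apply: aeW => t _.
  have near0 : \forall n \near \oo,
      sup_norm setT (fun x => trunc_field c n t x - field alpha c t x) = 0%E.
    exists (step t).+1 => // n /= tn; rewrite /trunc_field tn.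
    by rewrite -[RHS](sup_norm0 2); congr sup_norm; apply/funext => x; rewrite subrr.
  apply: cvg_trans (@cvg_cst _ 0%E _ \oo _).
  apply: near_eq_cvg; near=> n; apply/esym; near: n; exact: near0.
- have mn : measurable_fun (`[0, 1]%classic : set R)
      (fun t => sup_norm setT (field alpha c t)).
    apply: measurable_fun_steps => j.
    apply: (eq_measurable_fun (cst (sup_norm setT (shear alpha j (c j))))) => //.
    by move=> t; rewrite inE /= in_itv/= => h; rewrite (fieldE _ _ h).
  have n0 t : (0 <= sup_norm setT (field alpha c t))%E.
    apply: (@le_trans _ _ (eucl_norm (field alpha c t 0))%:E).
      by rewrite lee_fin eucl_normE sqrtr_ge0.
    by apply: ereal_sup_ubound; exists 0.
  pose I01 : set R := `[0, 1]%classic.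
  apply: (@le_lt_trans _ _ (\int[mu]_(t in I01) cst (1 / 2)%:E t)%E).
    apply: ge0_le_integral => //= t _.
    exact: sup_norm_field.
  have m1 : mu I01 = 1%E.
    by rewrite lebesgue_measure_itv /= lte_fin ltr01 -EFinB subr0.
  have mI : measurable I01 by exact: measurable_itv.
  have -> : (\int[mu]_(t in I01) cst (1 / 2)%:E t = (1 / 2)%:E * mu I01)%E.
    exact: integral_cst.
  by rewrite m1 mule1 ltry.
Unshelve. all: by end_near. Qed.

Lemma random_field_digit :
  random_field 1 (fun w : measurableTypeR R => field alpha (digit w)).
Proof.
split; first exact: measurable_random_field.
by move=> w; exact: field_in_L1C0.
Qed.

End random_field.

(** * Separation of trajectories and nonuniqueness *)

Section nonuniqueness.
Context (R : realType) (alpha : R).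
Hypotheses (alpha_ge0 : 0 <= alpha) (alpha_lt : alpha < 1 / 2).
Context (W : R -> 'rV[R]_2) (beta : R).
Hypothesis beta_gt : hexp alpha < beta.
Hypothesis W_holder : in_holder (@abs_dist R) `[0, 1] beta W.
Implicit Types (c : nat -> nat) (j k m r d : nat) (t : R) (x y z p q : 'rV[R]_2).

Local Notation time := (@time R).
Local Notation dur := (@dur R).
Local Notation scl := (scl alpha).
Local Notation amp := (amp alpha).
Local Notation rate := (rate alpha).
Local Notation step_map := (step_map alpha W).
Local Notation step_inv := (step_inv alpha W).

Let W_cont : {within `[0, 1], continuous W} := W_holder.1.

Lemma holder_path_bound : exists2 C : R, 0 <= C &
  forall s t, 0 <= s <= 1 -> 0 <= t <= 1 ->
    eucl_norm (W s - W t) <= C * `|s - t| `^ beta.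
Proof.
have b0 : 0 < beta by apply: lt_trans beta_gt; exact: hexp_gt0.
have [_] := W_holder; rewrite /holder_norm gt_eqF//.
set S := sup_norm _ _; set H := holder_seminorm _ _ _ _ => SH.
pose I01 : set R := `[0, 1]%classic.
have S0 : (0 <= S)%E.
  apply: (@le_trans _ _ (eucl_norm (W 0))%:E).
    by rewrite lee_fin eucl_normE sqrtr_ge0.
  by apply: ereal_sup_ubound; exists 0 => //=; rewrite in_itv/= lexx ler01.
have Hub s t : I01 s -> I01 t -> s <> t ->
    ((eucl_norm (W s - W t) / `|s - t| `^ beta)%:E <= H)%E.
  by move=> hs ht st; apply: ereal_sup_ubound; exists (s, t).
have H0 : (0 <= H)%E.
  apply: le_trans (Hub 0 1 _ _ _).
  - by rewrite lee_fin divr_ge0 ?powR_ge0// eucl_normE sqrtr_ge0.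
  - by rewrite /I01 /= in_itv/= lexx ler01.
  - by rewrite /I01 /= in_itv/= lexx ler01.
  - by apply/eqP; rewrite eq_sym oner_eq0.
have Hfin : H \is a fin_num.
  by rewrite ge0_fin_numE//; apply: le_lt_trans SH; rewrite leeDr.
exists (fine H); first exact: fine_ge0.
move=> s t hs ht; have [->|st] := eqVneq s t.
  by rewrite subrr eucl_normE sqnE !mxE expr0n addr0 sqrtr0 mulr_ge0 ?powR_ge0 ?fine_ge0.
have : ((eucl_norm (W s - W t) / `|s - t| `^ beta)%:E <= H)%E.
  by apply: Hub => //; exact/eqP.
rewrite -(fineK Hfin) lee_fin ler_pdivrMr// powR_gt0//.
by rewrite normr_gt0 subr_eq0.
Qed.

Lemma norm_kdot_le d x : `|kdot d x| <= 2 * eucl_norm x.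
Proof.
rewrite -(ler_pXn2r (_ : 0 < 2)%N) ?nnegrE ?mulr_ge0 ?eucl_normE ?sqrtr_ge0//.
rewrite real_normK ?num_real// exprMn sqr_sqrtr ?sqn_ge0//.
apply: (le_trans (sqr_kdot_le _ _)).
by have := sqn_ge0 x; lra.
Qed.

Lemma near_angle_osc : \forall j \near \oo, forall d s,
  time j.+1 <= s <= time j ->
  `|angle alpha W j d s - angle alpha W j d (time j.+1)| <= 1 / 32.
Proof.
have [C C0 hC] := holder_path_bound.
have b0 : 0 < beta by apply: lt_trans beta_gt; exact: hexp_gt0.
pose a := (64 * (C + 1))^-1.
have C1 : 0 < C + 1 by lra.
have a0 : 0 < a by rewrite invr_gt0 mulr_gt0.
near=> j => d s /andP[h1 h2].
have hj : dur j `^ beta <= a * scl j.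
  by near: j; exact: near_dur_powR_le.
have s0 := scl_gt0 alpha j.
rewrite /angle -mulrBl -kdotB normrM (ger0_norm (_ : 0 <= (scl j)^-1)); last first.
  by rewrite invr_ge0 ltW.
rewrite ler_pdivrMr//; apply: (le_trans (norm_kdot_le _ _)).
have t0 := time_gt0 R j.+1; have t1 := time_le1 R j.
have hs : 0 <= s <= 1 by lra.
have ht : 0 <= time j.+1 <= 1 by lra.
have := hC _ _ hs ht.
have : `|s - time j.+1| `^ beta <= dur j `^ beta.
  rewrite ge0_ler_powR ?nnegrE ?(ltW b0) ?(ltW (dur_gt0 _ _))//.
  by rewrite ger0_norm ?subr_ge0// lerD2r.
move=> e1 e2.
have e3 : C * `|s - time j.+1| `^ beta <= C * (a * scl j).
  by rewrite ler_wpM2l// (le_trans e1).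
apply: (@le_trans _ _ (2 * (C * (a * scl j)))).
  by rewrite ler_wpM2l// (le_trans e2).
have : C * a <= 1 / 64.
  rewrite /a ler_pdivrMr ?mulr_gt0//; lra.
move=> e4; rewrite (_ : 2 * (C * (a * scl j)) = 2 * (C * a) * scl j); last by ring.
by rewrite ler_wpM2r ?(ltW s0)//; lra.
Unshelve. all: by end_near. Qed.

(** The flow from [time (j + k)] to the later time [time j], in the frame moving
    with [W]. *)
Fixpoint forward c j k p : 'rV[R]_2 :=
  if k is k'.+1 then step_map c j (forward c j.+1 k' p) else p.

Lemma forward_eq c c' j k p : (forall i, (j <= i < j + k)%N -> c i = c' i) ->
  forward c j k p = forward c' j k p.
Proof.
elim: k j => // k IH j h /=; rewrite (IH j.+1).
  by rewrite /step_map h// leqnn addnS ltnS leq_addr.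
by move=> i /andP[h1 h2]; apply: h; rewrite (ltnW h1) -addSnnS.
Qed.

Lemma step_map_inj c j : injective (step_map c j).
Proof. exact: can_inj (@shiftK _ _ _ _ _). Qed.

Lemma step_inv_inj c j : injective (step_inv c j).
Proof. exact: can_inj (@unshiftK _ _ _ _ _). Qed.

Lemma forward_inj c j k : injective (forward c j k).
Proof. by elim: k j => [|k IH] j //= x y /step_map_inj /IH. Qed.

Lemma forward_coord_le c j k p i :
  `|forward c j k p 0 i - p 0 i| <= time j - time (j + k).
Proof.
elim: k j => [|k IH] j /=; first by rewrite addn0 !subrr normr0.
set x := forward c j.+1 k p.
have := IH j.+1; have := disp_coord_le alpha_ge0 alpha_lt W_cont c j x i.
rewrite -/x addnS -addSn /step_map /shift /dur.
move: (disp _ _ _ _ _) => D h1 h2; rewrite mxE.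
rewrite (_ : _ + _ - _ = D 0 i + (x 0 i - p 0 i)); last by ring.
by apply: (le_trans (ler_normD _ _)); lra.
Qed.

Definition good_step j := [/\ rate j <= 1 / 4000,
  forall d s, time j.+1 <= s <= time j ->
    `|angle alpha W j d s - angle alpha W j d (time j.+1)| <= 1 / 32
  & scl j * (1 - 1 / 256 * rate j ^+ 2) <= scl j.+1].

Lemma near_good_step : \forall j \near \oo, good_step j.
Proof.
have a1 : 0 < 1 / 4000 :> R by lra.
have a2 : 0 < 1 / 256 :> R by lra.
near=> j; split; near: j.
- exact: near_rate_le.
- exact: near_angle_osc.
- exact: near_sclS_ge.
Unshelve. all: by end_near. Qed.

(** The mean inverse distance stays of the order of the inverse of the current
    scale, uniformly in the much smaller initial scale: the one-step contraction
    makes up for the change of scale, and half of it absorbs the additive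
    term. *)
Lemma avg_inv_dist_le j k M p q : (forall i, (j <= i)%N -> good_step i) ->
    (j + k <= M)%N -> eucl_norm (p - q) = scl (j + k) ->
  avg M (fun c => (eucl_norm (forward c j k p - forward c j k q))^-1) <= 64 * 256 / scl j.
Proof.
have K1 : 1 <= 64 * 256 :> R by lra.
have K0 : 0 < 64 * 256 :> R by lra.
elim: k j => [|k IH] j good jkM pq.
  rewrite /= avg_cst pq addn0 ler_peMl// invr_ge0.
  exact/ltW/scl_gt0.
have pneq : p != q.
  rewrite -subr_eq0; apply/eqP => e; have := scl_gt0 alpha (j + k.+1).
  by rewrite -pq e eucl_normE sqnE !mxE expr0n addr0 sqrtr0 ltxx.
have jM : (j < M)%N by rewrite (leq_trans _ jkM)// addnS ltnS leq_addr.
have l0 := scl_gt0 alpha j; have l1 := scl_gt0 alpha j.+1.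
have [hr hosc hs] := good _ (leqnn j).
set h := rate j in hr hs.
have h0 : 0 < h by exact: rate_gt0.
rewrite -(avg_avg_digit _ jM).
pose G c := (eucl_norm (forward c j.+1 k p - forward c j.+1 k q))^-1.
apply: (@le_trans _ _ (avg M (fun c => (1 - h ^+ 2 / 128) * G c + 64 * h ^+ 2 / scl j))).
  apply: le_avg => c; rewrite /avg_digit.
  have updE r x : forward (upd c j r) j k.+1 x =
      shift (amp j) (scl j) (trig_int alpha W j) r (forward c j.+1 k x).
    rewrite /= /step_map {1}/upd eqxx; congr (shift _ _ _ _ _).
    by apply: forward_eq => i /andP[ji _]; rewrite /upd gtn_eqF.
  under eq_bigr do rewrite !updE.
  apply: (inv_dist_shift_avg _ l0 (dur_gt0 R j)) => //.
  - exact: amp_gt0.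
  - move=> d; rewrite trig_int_sqr_le// andbT; apply: trig_int_sqr_ge => // s.
    exact: hosc.
  - by apply: contra pneq => /eqP /forward_inj ->.
rewrite avg_affine.
have ih : avg M G <= 64 * 256 / scl j.+1.
  apply: IH; last by rewrite addSnnS.
    by move=> i ji; apply: good; exact: ltnW.
  by rewrite addSnnS.
have h1 : h <= 1 by lra.
have h2 : h ^+ 2 <= 1 by rewrite exprn_ile1// ltW.
have h2p : 0 <= h ^+ 2 by exact: sqr_ge0.
set a := 1 / 256 * h ^+ 2 in hs.
have a0 : 0 <= a by rewrite /a; lra.
have a1 : a <= 1 / 4 by rewrite /a; lra.
have -> : h ^+ 2 / 128 = 2 * a by rewrite /a; lra.
have -> : 64 * h ^+ 2 / scl j = 64 * 256 * a / scl j.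
  by congr (_ / _); rewrite /a; lra.
have p1 : 0 < 1 - a by lra.
move: (64 * 256) K0 ih => K K0 ih.
have h3 : avg M G <= K / (scl j * (1 - a)).
  apply: (le_trans ih); rewrite ler_pM2l// lef_pV2 ?posrE//.
  by rewrite mulr_gt0.
have h4 : (1 - 2 * a) * avg M G <= (1 - 2 * a) * (K / (scl j * (1 - a))).
  by rewrite ler_wpM2l//; lra.
apply: (le_trans (lerD h4 (lexx _))).
have h5 : (1 - 2 * a) * (K / (scl j * (1 - a))) <= (1 - a) * (K / scl j).
  rewrite invfM (_ : _ * (_ * (_ * _)) = (1 - 2 * a) / (1 - a) * (K / scl j)); last by ring.
  rewrite ler_wpM2r ?divr_ge0 ?(ltW l0) ?(ltW K0)// ler_pdivrMr//.
  by have := sqr_ge0 a; rewrite expr2; lra.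
apply: (le_trans (lerD h5 (lexx _))).
by rewrite le_eqVlt; apply/orP; left; apply/eqP; ring.
Qed.

(** The inverse flow from [time m] to the earlier time [time (m + k)]. *)
Fixpoint backward c m k x : 'rV[R]_2 :=
  if k is k'.+1 then step_inv c (m + k') (backward c m k' x) else x.

Lemma backward_forward c m k k' p : backward c m k (forward c m (k + k') p) = forward c (m + k) k' p.
Proof.
elim: k k' => [|k IH] k'; first by rewrite addn0.
rewrite addSnnS /= IH /= /step_inv /step_map shiftK.
by rewrite addnS.
Qed.

Lemma backward_inj c m k : injective (backward c m k).
Proof. by elim: k => [|k IH] //= x y /step_inv_inj /IH. Qed.

Lemma step_inv_continuous c j : continuous (step_inv c j).
Proof.
move=> x.
set r := c j; set C := (trig_int alpha W j (dir r)).1; set S := (trig_int alpha W j (dir r)).2.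
have c1 : {for x, continuous (fun x => kdot (dir r) x / scl j)}.
  exact: (@cvgMr_tmp _ _ _ _ _ _ _ (@continuous_kdot R (dir r) x)).
have c2 : {for x, continuous (fun x => rprof C S (phase r) (kdot (dir r) x / scl j))}.
  exact: (@continuous_comp _ _ _ _ _ x c1 (@continuous_rprof R C S (phase r) _)).
have c3 : {for x, continuous (fun x => amp j * rprof C S (phase r) (kdot (dir r) x / scl j))}.
  exact: (@cvgMl_tmp _ _ _ _ _ _ _ c2).
have c4 : {for x, continuous (fun x =>
    (amp j * rprof C S (phase r) (kdot (dir r) x / scl j)) *: edir R (dir r))}.
  exact: (@cvgZr_tmp _ _ _ _ _ _ _ _ c3).
have ci : {for x, continuous (@id 'rV[R]_2)} by exact: cvg_id.
exact: (continuousB ci c4).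
Qed.

Lemma backward_continuous c m k : continuous (backward c m k).
Proof.
elim: k => [|k IH] x /=; first exact: cvg_id.
exact: (@continuous_comp _ _ _ _ _ x (IH x) (@step_inv_continuous c (m + k) _)).
Qed.

(** The full orbit through [x] at [time m], in both directions of time. *)
Definition join_orbit c m x j : 'rV[R]_2 :=
  if (m <= j)%N then backward c m (j - m) x else forward c j (m - j) x.

Lemma join_orbitS c m x j : join_orbit c m x j = step_map c j (join_orbit c m x j.+1).
Proof.
rewrite /join_orbit; have [mj|jm] := leqP m j.
  by rewrite (leqW mj) subSn//= subnKC// /step_inv /step_map unshiftK.
rewrite -(subnSK jm) /=; congr step_map.
have [mj|//] := leqP m j.+1.
have -> : m = j.+1 by apply/eqP; rewrite eqn_leq mj jm.
by rewrite subnn.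
Qed.

Lemma join_orbit_start c m x p i :
    (forall k, `|backward c m k x 0 i - p 0 i| <= time (m + k)) ->
  forall j, `|join_orbit c m x j 0 i - p 0 i| <= time j.
Proof.
move=> h j; rewrite /join_orbit; have [mj|jm] := leqP m j.
  by have := h (j - m)%N; rewrite subnKC.
have := h 0%N; rewrite addn0 /= => h0.
have := forward_coord_le c j (m - j) x i; rewrite subnKC ?(ltnW jm)// => h1.
rewrite (_ : _ - _ = (forward c j (m - j) x 0 i - x 0 i) + (x 0 i - p 0 i)); last by ring.
by apply: (le_trans (ler_normD _ _)); lra.
Qed.

Lemma coord_le_norm x i : `|x 0 i| <= `|x|.
Proof.
rewrite [leRHS]/Num.norm /= mx_normrE.
exact: (le_bigmax _ (fun ij : 'I_1 * 'I_2 => `|x ij.1 ij.2|) (0, i)).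
Qed.

Lemma eucl_norm_le x : eucl_norm x <= 2 * `|x|.
Proof.
rewrite -(ler_pXn2r (_ : 0 < 2)%N) ?nnegrE ?mulr_ge0 ?eucl_normE ?sqrtr_ge0//.
rewrite sqr_sqrtr ?sqn_ge0// sqnE exprMn.
have h i : x 0 i ^+ 2 <= `|x| ^+ 2.
  by rewrite -(real_normK (num_real (x 0 i))) lerXn2r ?nnegrE// coord_le_norm.
by have := h 0; have := h 1; have := sqr_ge0 `|x|; lra.
Qed.

(** Compactness.  The conditions on the backward orbits are closed, because the
    inverse flow is continuous, and for each [k] they hold eventually; so they
    pass to a cluster point of the pairs [(a N, b N)].  Restricting to the [N]
    for which the pair is separated keeps the two components apart. *)
Lemma separated_limits c m p (a b : nat -> 'rV[R]_2) (rho : R) : 0 < rho ->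
    (forall k N, (m + k <= N)%N -> forall i,
      `|backward c m k (a N) 0 i - p 0 i| <= time (m + k) /\
      `|backward c m k (b N) 0 i - p 0 i| <= time (m + k)) ->
    (forall M, exists2 N, (M <= N)%N & rho <= eucl_norm (a N - b N)) ->
  exists x y, [/\ x <> y,
    forall k i, `|backward c m k x 0 i - p 0 i| <= time (m + k) &
    forall k i, `|backward c m k y 0 i - p 0 i| <= time (m + k)].
Proof.
move=> rho0 hab sep.
pose T := ('rV[R]_2 * 'rV[R]_2)%type.
pose B M : set nat := [set N | (M <= N)%N /\ rho <= eucl_norm (a N - b N)].
pose F0 : set_system nat := filter_from setT B.
have FF0 : ProperFilter F0.
  apply: filter_from_proper; last by move=> M _; have [N] := sep M; exists N.
  apply: filter_from_filter; first by exists 0%N.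
  move=> M M' _ _; exists (maxn M M') => // N [].
  by rewrite geq_max => /andP[h1 h2] h3.
pose A : set 'rV[R]_2 := [set v | forall i, `[p 0 i - 1, p 0 i + 1]%classic (v 0 i)].
have cA : compact A.
  by apply: (@rV_compact R 2 (fun i => `[p 0 i - 1, p 0 i + 1]%classic)) => i;
    exact: segment_compact.
have cAA : compact (A `*` A) by exact: compact_setX.
pose f N : T := (a N, b N).
have FAA : (f @ F0) (A `*` A).
  exists m => // N [mN _]; rewrite /f /=.
  have inA (v : 'rV[R]_2) : (forall i, `|v 0 i - p 0 i| <= time m) -> A v.
    move=> h i; rewrite /= in_itv/=; have := time_le1 R m; have := h i.
    by rewrite ler_norml => /andP[h1 h2] h3; apply/andP; split; lra.
  by split; apply: inA => i; have := hab 0%N N; rewrite addn0 => /(_ mN i) [].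
have [[x y] [_]] := cAA _ _ FAA.
rewrite clusterE => cl; exists x, y.
have closed_in (C : set T) : closed C -> (exists M, forall N, B M N -> C (f N)) -> C (x, y).
  move=> cC [M hM]; rewrite (closure_id C).1//; apply: cl.
  by exists M => // N /hM.
split.
- have : [set q : T | rho / 2 <= `|q.1 - q.2|] (x, y).
    apply: closed_in.
      have cc : continuous (fun q : T => `|q.1 - q.2|).
        move=> q; apply: cvg_norm.
        have c1 : {for q, continuous (fun q : T => q.1)} by exact: cvg_fst.
        have c2 : {for q, continuous (fun q : T => q.2)} by exact: cvg_snd.
        exact: (continuousB c1 c2).
      by move/continuous_closedP : cc => /(_ [set s | rho / 2 <= s]); apply; exact: closed_ge.
    exists 0%N => N [_ h] /=; rewrite ler_pdivrMr// mulrC.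
    exact: le_trans h (eucl_norm_le _).
  by move=> /= h e; rewrite e subrr normr0 leNgt divr_gt0 in h.
- move=> k i; have : [set q : T | `|backward c m k q.1 0 i - p 0 i| <= time (m + k)] (x, y); last by [].
  apply: closed_in.
    have cc : continuous (fun q : T => `|backward c m k q.1 0 i - p 0 i|).
      move=> q; apply: cvg_norm.
      have c1 : {for q, continuous (fun q : T => backward c m k q.1)}.
        exact: (@continuous_comp _ _ _ fst (backward c m k) q cvg_fst (@backward_continuous c m k _)).
      have c2 : {for q, continuous (fun q : T => backward c m k q.1 0 i)}.
        exact: (@continuous_comp _ _ _ _ _ q c1 (@coord_continuous R 1 2 0 i _)).
      exact: (continuousB c2 (@cst_continuous _ _ (p 0 i) q)).
    by move/continuous_closedP : cc => /(_ [set s | s <= time (m + k)]); apply; exact: closed_le.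
  by exists (m + k)%N => N [h _] /=; have [] := hab _ _ h i.
- move=> k i; have : [set q : T | `|backward c m k q.2 0 i - p 0 i| <= time (m + k)] (x, y); last by [].
  apply: closed_in.
    have cc : continuous (fun q : T => `|backward c m k q.2 0 i - p 0 i|).
      move=> q; apply: cvg_norm.
      have c1 : {for q, continuous (fun q : T => backward c m k q.2)}.
        exact: (@continuous_comp _ _ _ snd (backward c m k) q cvg_snd (@backward_continuous c m k _)).
      have c2 : {for q, continuous (fun q : T => backward c m k q.2 0 i)}.
        exact: (@continuous_comp _ _ _ _ _ q c1 (@coord_continuous R 1 2 0 i _)).
      exact: (continuousB c2 (@cst_continuous _ _ (p 0 i) q)).
    by move/continuous_closedP : cc => /(_ [set s | s <= time (m + k)]); apply; exact: closed_le.
  by exists (m + k)%N => N [h _] /=; have [] := hab _ _ h i.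
Qed.

(** Distinct points at [time m] have distinct backward orbits, so the two
    solutions differ at arbitrarily small times. *)
Lemma nonunique_of_limits c m (y x1 x2 : 'rV[R]_2) : x1 <> x2 ->
    (forall k i, `|backward c m k x1 0 i - (y - W 0) 0 i| <= time (m + k)) ->
    (forall k i, `|backward c m k x2 0 i - (y - W 0) 0 i| <= time (m + k)) ->
  forall eps, 0 < eps -> eps <= 1 ->
    nonunique_caratheodory eps (field alpha c) W y.
Proof.
move=> x12 h1 h2 eps eps0 eps1.
pose z1 := join_orbit c m x1; pose z2 := join_orbit c m x2.
have s1 j i : `|z1 j 0 i - (y - W 0) 0 i| <= time j by exact: join_orbit_start.
have s2 j i : `|z2 j 0 i - (y - W 0) 0 i| <= time j by exact: join_orbit_start.
have o1 := join_orbitS c m x1; have o2 := join_orbitS c m x2.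
have he : 0 < eps <= 1 by rewrite eps0.
exists (orbit_sol alpha W c y z1), (orbit_sol alpha W c y z2); split.
- exact: orbit_sol_caratheodory.
- exact: orbit_sol_caratheodory.
have [N _ hN] := near_time_le eps0.
pose j := maxn m N.
exists (time j); first by rewrite in_itv/= (ltW (time_gt0 _ _)) hN//= leq_maxr.
rewrite !orbit_sol_time// => /addIr.
rewrite /z1 /z2 /join_orbit leq_maxl => /backward_inj.
exact: x12.
Qed.

Lemma ae_nonunique (y : 'rV[R]_2) :
  {ae uniform_prob (@ltr01 R), forall w, forall eps, 0 < eps -> eps <= 1 ->
    nonunique_caratheodory eps (field alpha (digit w)) W y}.
Proof.
have [m _ good] := near_good_step.
pose p := y - W 0.
pose e1 := edir R 0.
have e1E : eucl_norm e1 = 1.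
  by rewrite eucl_normE sqnE !edirE expr1n expr0n addr0 sqrtr1.
(* The second trajectory starts at the distance [scl N] from the first one. *)
pose q N := p + scl N *: e1.
have pq N : eucl_norm (p - q N) = scl N.
  by rewrite /q opprD addrA subrr sub0r -scaleNr eucl_normZ e1E mulr1 normrN gtr0_norm ?scl_gt0.
pose D N c := eucl_norm (forward c m (N - m) p - forward c m (N - m) (q N)).
have Dfit N c c' : (forall i, (i < N)%N -> c i = c' i) -> D N c = D N c'.
  move=> h; rewrite /D; have [mN|Nm] := leqP m N.
    by rewrite !(forward_eq (c := c) (c' := c')) // => i /andP[_]; rewrite subnKC// => /h.
  by rewrite (eqP (_ : N - m == 0)%N) // subn_eq0 ltnW.
have D0 N c : (m <= N)%N -> 0 < D N c.
  move=> mN; apply: eucl_norm_gt0; rewrite subr_eq0; apply/eqP => /forward_inj e.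
  have := scl_gt0 alpha N; rewrite -pq -e subrr eucl_normE sqnE !mxE.
  by rewrite expr0n addr0 sqrtr0 ltxx.
have DK N : (m <= N)%N -> avg N (fun c => (D N c)^-1) <= 64 * 256 / scl m.
  move=> mN; apply: avg_inv_dist_le; first by move=> i; exact: good.
    by rewrite subnKC.
  by rewrite subnKC.
have := ae_frequently_ge Dfit D0 DK.
apply: negligibleS => w /= nQ hfr; apply: nQ; case: hfr => rho rho0 hfreq.
have start N k i : (m + k <= N)%N ->
    `|backward (digit w) m k (forward (digit w) m (N - m) p) 0 i - p 0 i| <= time (m + k) /\
    `|backward (digit w) m k (forward (digit w) m (N - m) (q N)) 0 i - p 0 i| <= time (m + k).
  move=> mkN.
  have -> : (N - m = k + (N - (m + k)))%N by rewrite subnDA subnKC// leq_subRL// (leq_trans _ mkN)// leq_addr.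
  rewrite !backward_forward.
  have h0 := forward_coord_le (digit w) (m + k) (N - (m + k)) p i.
  have h1 := forward_coord_le (digit w) (m + k) (N - (m + k)) (q N) i.
  rewrite subnKC// in h0 h1.
  have tN := time_gt0 R N.
  split; first by apply: (le_trans h0); lra.
  have hq : `|q N 0 i - p 0 i| <= time N.
    rewrite /q !mxE addrC addKr normrM ger0_norm ?(ltW (scl_gt0 _ _))//.
    apply: le_trans (scl_le_time alpha_ge0 alpha_lt N).
    rewrite ler_piMr ?(ltW (scl_gt0 _ _))//.
    by case: (i == 0); rewrite ?normr1 ?normr0.
  rewrite (_ : _ - _ = (forward (digit w) (m + k) (N - (m + k)) (q N) 0 i - q N 0 i)
    + (q N 0 i - p 0 i)); last by ring.
  by apply: (le_trans (ler_normD _ _)); lra.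
have [x1 [x2 [x12 h1 h2]]] := @separated_limits (digit w) m p
  (fun N => forward (digit w) m (N - m) p) (fun N => forward (digit w) m (N - m) (q N))
  rho rho0 (fun k N h i => start N k i h) hfreq.
exact: nonunique_of_limits x12 h1 h2.
Qed.

End nonuniqueness.

Theorem corollary1p10 (R : realType) (alpha : R)
    (halpha0 : 0 <= alpha) (halpha1 : alpha < 1 / 2) :
  exists (dsp : measure_display) (Omega : measurableType dsp)
    (P : probability Omega R) (u : Omega -> R -> 'rV[R]_2 -> 'rV[R]_2),
    [/\ random_field 1 u,
        forall (omega : Omega) (t : R), t \in `[0, 1] ->
          in_holder (@eucl_dist R 2) setT alpha (u omega t) /\
          (holder_norm (@eucl_dist R 2) setT alpha (u omega t) <= 2%:E)%E
      & forall (beta : R) (W : R -> 'rV[R]_2) (y : 'rV[R]_2),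
          1 / (2 * (1 - alpha)) < beta ->
          in_holder (@abs_dist R) `[0, 1] beta W ->
          {ae P, forall omega : Omega, forall eps : R, 0 < eps -> eps <= 1 ->
            nonunique_caratheodory eps (u omega) W y}].
Proof.
exists _, (measurableTypeR R), (uniform_prob (@ltr01 R)),
  (fun w => field alpha (digit w)); split.
- exact: random_field_digit.
- move=> w t _; split; first by apply: field_in_holder => //; right.
  by apply: holder_norm_field => //; right.
- move=> beta W y hbeta hW; exact: (ae_nonunique halpha0 halpha1 hbeta hW).
Qed.
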